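(* Let $I \subseteq R=\Bbbk[x_1,\dots,x_n]$ be a monomial ideal of linear-power type, let $\{v_1,\dots,v_r\}$ be the vertices of $\mathrm{SP}(I)$, and let $c$ be the least common multiple of the denominators appearing in the coordinates of $v_1,\dots,v_r$. \begin{enumerate} \item If $d \in \mathbb{N}$ is any integer such that $I^{(dk)} = \left(I^{(d)}\right)^k$ for all $k \in \mathbb{N}$, then $d$ is a multiple of $c$. In particular, $\mathrm{svd}(I)$ is a multiple of $c$, and so $\mathrm{svd}(I) \ge c$. \item $\mathrm{svd}(I) \le (\ell_s(I)-1)c = \mathrm{mdc}(\mathrm{SP}(I))\,c$. \end{enumerate}
   Context: $\Bbbk$ is a field, $R = \Bbbk[x_1,\dots,x_n]$, $\mathfrak{m} = (x_1,\dots,x_n)$, and $\mathbb{N}$ denotes the positive integers. For $\mathbf{a} \in \mathbb{Z}^n_{\ge 0}$, $x^{\mathbf a} = x_1^{a_1}\cdots x_n^{a_n}$. A monomial ideal $I$ is of linear-power type if $I = \bigcap_{\mathfrak{p}\in \mathrm{Min}(I)} \mathfrak{p}^{\omega_{\mathfrak p}}$ with $\omega_{\mathfrak p} \in \mathbb{N}$, where $\mathrm{Min}(I)$ is the set of minimal primes of $I$ and all minimal primes of $I$ are monomial primes (generated by subsets of the variables); squarefree monomial ideals are of this type. The $k$-th symbolic power is $I^{(k)} = \bigcap_{\mathfrak{p} \in \mathrm{Ass}(I)} (I^k R_{\mathfrak{p}} \cap R)$, where $\mathrm{Ass}(I)$ is the set of associated primes of $I$. The Newton polyhedron $\mathrm{NP}(I)$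 is the convex hull in $\mathbb{R}^n$ of $\{\mathbf{a} \in \mathbb{Z}^n_{\ge 0} : x^{\mathbf{a}} \in I\}$. The symbolic polyhedron is $\mathrm{SP}(I) = \bigcap_{\mathfrak{p} \in \mathrm{maxAss}(I)} \mathrm{NP}(R \cap I R_{\mathfrak{p}})$, where $\mathrm{maxAss}(I)$ is the set of maximal elements of $\mathrm{Ass}(I)$; it is a rational polyhedron. The symbolic Rees algebra is $\mathcal{R}_s(I) = \bigoplus_{k\ge 0} I^{(k)}t^k \subseteq R[t]$, with $I^{(0)}=R$, and the symbolic analytic spread is $\ell_s(I) = \dim (\mathcal{R}_s(I)/\mathfrak{m}\mathcal{R}_s(I))$. The symbolic Veronese degree is $\mathrm{svd}(I) = \inf\{d\in\mathbb{N} : I^{(dk)} = (I^{(d)})^k \text{ for all } k\in\mathbb{N}\}$. For a polyhedron $P$, $\mathrm{mdc}(P)$ is the maximum dimension of a compact face of $P$.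
   Formalization: In (2), I is assumed nonzero and proper, and the inequality svd(I) ≤ (ℓ_s(I)−1)c is claimed only when ℓ_s(I) > 1, since for ℓ_s(I) = 1 (e.g. I = (x_1), svd = 1) its right side is 0; the equality ℓ_s(I)−1 = mdc(SP(I)) is kept for all nonzero proper I. *)

(* Defs.v *)
From HB Require Import structures.
From mathcomp Require Import all_boot all_order all_algebra.
From mathcomp Require Import boolp classical_sets reals topology normedtype.
From mathcomp Require Import convex.
(* mpoly's notations clash with those of mathcomp-analysis *)
From mathcomp Require Import -(notations) mpoly.

Set Implicit Arguments.
Unset Strict Implicit.
Unset Printing Implicit Defensive.

Import Order.TTheory GRing.Theory Num.Theory.
Import numFieldNormedType.Exports.

Local Open Scope classical_set_scope.
Local Open Scope ring_scope.

Section Ideals.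
Variable A : comNzRingType.
Implicit Types (J K P : set A).

Definition is_ideal J :=
  [/\ J 0, forall x y, J x -> J y -> J (x + y) & forall a x, J x -> J (a * x)].

Definition ideal_gen (S : set A) : set A := smallest is_ideal S.

Definition ideal_mul J K : set A := ideal_gen [set x * y | x in J & y in K].

Definition ideal_pow J (k : nat) : set A := iter k (ideal_mul J) setT.

Definition prime_ideal P :=
  [/\ is_ideal P, ~ P 1 & forall x y, P (x * y) -> P x \/ P y].

Definition min_prime J P :=
  [/\ prime_ideal P, J `<=` P &
      forall Q, prime_ideal Q -> J `<=` Q -> Q `<=` P -> Q = P].

(* P is the annihilator of the class of some f in A / J *)
Definition assoc_prime J P :=
  prime_ideal P /\ exists f, P = [set g | J (g * f)].

Definition max_assoc_prime J P :=
  assoc_prime J P /\ forall Q, assoc_prime J Q -> P `<=` Q -> Q = P.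

Definition prime_chain (d : nat) (P : 'I_d.+1 -> set A) :=
  (forall i, prime_ideal (P i)) /\
  (forall i j : 'I_d.+1, (i < j)%N -> P i `<` P j).

End Ideals.

Definition krull_dim (A : comNzRingType) (d : nat) :=
  (exists P : 'I_d.+1 -> set A, prime_chain P) /\
  (forall (e : nat) (Q : 'I_e.+1 -> set A), prime_chain Q -> (e <= d)%N).

Section Localization.
Variable A : idomainType.
Implicit Types (J P : set A).

(* The extended ideal J A_P, inside the fraction field of A *)
Definition ideal_at J P : set {fraction A} :=
  [set tofrac a / tofrac s | a in J & s in ~` P].

(* The contraction A `&` J A_P *)
Definition contract_at J P : set A := @tofrac A @^-1` ideal_at J P.

Definition symb_pow J (k : nat) : set A :=
  \bigcap_(P in assoc_prime J) contract_at (ideal_pow J k) P.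

Definition symb_veronese J (d : nat) :=
  forall k, (0 < k)%N -> symb_pow J (d * k) = ideal_pow (symb_pow J d) k.

(* s is the infimum, attained, of the positive d such that
   J^(dk) = (J^(d))^k for all k > 0 *)
Definition is_svd J (s : nat) :=
  [/\ (0 < s)%N, symb_veronese J s &
      forall d, (0 < d)%N -> symb_veronese J d -> (s <= d)%N].

End Localization.

Section Monomial.
Variables (k : fieldType) (n : nat).
Implicit Types (I : set (mpoly n k)).

Definition monomial_ideal I :=
  exists S : set (multinom n), I = ideal_gen [set mpolyX k m | m in S].

Definition linear_power_type I :=
  monomial_ideal I /\
  exists w : set (mpoly n k) -> nat,
    (forall P, min_prime I P -> (0 < w P)%N) /\
    I = \bigcap_(P in min_prime I) ideal_pow P (w P).

Definition irrelevant_ideal : set (mpoly n k) :=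
  ideal_gen [set mpolyX k (mnm1 i) | i in [set: 'I_n]].

End Monomial.

Section IdealFacts.
Variable A : comNzRingType.
Implicit Types (J K P S : set A).

Lemma ideal_gen_ideal S : is_ideal (ideal_gen S).
Proof.
split=> [J [[]]//|x y Jx Jy J JS|a x Jx J JS].
  by have [[_ JD _] _] := JS; apply: JD; [exact: Jx|exact: Jy].
by have [[_ _ JM] _] := JS; apply: JM; exact: Jx.
Qed.

Lemma ideal_pow_ideal J a : is_ideal (ideal_pow J a).
Proof. by case: a => [|a] //; exact: ideal_gen_ideal. Qed.

Lemma ideal_pow_mul J a b x y :
  ideal_pow J a x -> ideal_pow J b y -> ideal_pow J (a + b) (x * y).
Proof.
have powI c := ideal_pow_ideal J c.
elim: a x => [|a IHa] x Jx Jy.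
  by have [_ _] := powI b; rewrite add0n; apply.
have [p0 pD pM] := powI (a.+1 + b).
have idl : is_ideal [set u | ideal_pow J (a.+1 + b) (u * y)].
  split=> [|u v ? ?|u v ?] /=; first by rewrite mul0r.
    by rewrite mulrDl; exact: pD.
  by rewrite -mulrA; exact: pM.
apply: (smallest_sub idl _ Jx) => _ [u Ju [v Jv <-]] /=.
rewrite -mulrA; apply: sub_gen_smallest.
by exists u => //; exists (v * y) => //; exact: IHa.
Qed.

End IdealFacts.

Section SymbolicFacts.
Variable A : idomainType.
Implicit Types (J P : set A).

Lemma contract_atP J P x : prime_ideal P ->
  contract_at J P x <-> exists2 s, ~ P s & J (x * s).
Proof.
move=> [[P0 _ _] _ _]; split=> [[a Ja [s Ps e]]|[s Ps Jxs]].
  exists s => //; suff -> : x * s = a by [].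
  apply/eqP; rewrite -tofrac_eq rmorphM /= -e mulfVK ?eqxx // tofrac_eq0.
  by apply/eqP => s0; apply: Ps; rewrite s0.
exists (x * s) => //; exists s => //.
rewrite rmorphM /= mulfK // tofrac_eq0.
by apply/eqP => s0; apply: Ps; rewrite s0.
Qed.

Lemma symb_pow_ideal J k : is_ideal (symb_pow J k).
Proof.
have [p0 pD pM] := ideal_pow_ideal J k.
split=> [P [pP _]|x y Jx Jy P asP|a x Jx P asP].
- by have [_ P1 _] := pP; apply/contract_atP => //; exists 1; rewrite ?mul0r.
- have [pP _] := asP; have [_ _ Pp] := pP.
  have /(contract_atP _ _ pP)[s Ps Js] := Jx _ asP.
  have /(contract_atP _ _ pP)[t Pt Jt] := Jy _ asP.
  apply/contract_atP => //; exists (s * t); first by move/Pp => [].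
  by rewrite mulrDl; apply: pD; [rewrite [s * t]mulrC|]; rewrite mulrCA; apply: pM.
- have [pP _] := asP; have /(contract_atP _ _ pP)[s Ps Js] := Jx _ asP.
  by apply/contract_atP => //; exists s => //; rewrite -mulrA; exact: pM.
Qed.

Lemma symb_pow0 J x : symb_pow J 0 x.
Proof.
by move=> P [pP _]; have [_ P1 _] := pP; apply/contract_atP => //; exists 1.
Qed.

Lemma symb_pow_mul J a b x y :
  symb_pow J a x -> symb_pow J b y -> symb_pow J (a + b) (x * y).
Proof.
move=> Jx Jy P asP; have [pP _] := asP; have [_ _ Pp] := pP.
have /(contract_atP _ _ pP)[s Ps Js] := Jx _ asP.
have /(contract_atP _ _ pP)[t Pt Jt] := Jy _ asP.
apply/contract_atP => //; exists (s * t); first by move/Pp => [].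
by rewrite mulrACA; exact: ideal_pow_mul.
Qed.

End SymbolicFacts.

Section SymbolicRees.
Variables (k : fieldType) (n : nat) (I : set (mpoly n k)).

(* The subset of R[t] of the p whose coefficient of t^j lies in I^(j) *)
Definition symb_rees_pred : {pred {poly mpoly n k}} :=
  fun p => `[< forall j, symb_pow I j p`_j >].

Lemma symb_rees_subring : subring_closed symb_rees_pred.
Proof.
have S0 j : symb_pow I j 0 by have [] := symb_pow_ideal I j.
have SD j x y : symb_pow I j x -> symb_pow I j y -> symb_pow I j (x + y).
  by have [_ h _] := symb_pow_ideal I j; exact: h.
have SN j x : symb_pow I j x -> symb_pow I j (- x).
  by have [_ _ h] := symb_pow_ideal I j; rewrite -mulN1r; exact: h.
split=> [|p q /asboolP Ip /asboolP Iq|p q /asboolP Ip /asboolP Iq];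
  apply/asboolP => j.
- by rewrite coef1; case: j => [|j] /=; [exact: symb_pow0|exact: S0].
- by rewrite coefB; apply: SD => //; exact: SN.
- rewrite coefM; apply: (big_ind (symb_pow I j)) => // [|i _]; first exact: SD.
  have := symb_pow_mul (Ip i) (Iq (j - i)%N).
  by rewrite subnKC // -ltnS.
Qed.

HB.instance Definition _ :=
  GRing.isSubringClosed.Build _ symb_rees_pred symb_rees_subring.

Record symb_rees := SymbRees {
  symb_rees_val :> {poly mpoly n k};
  symb_rees_valP : symb_rees_val \in symb_rees_pred }.

HB.instance Definition _ := [isSub for symb_rees_val].
HB.instance Definition _ := [Choice of symb_rees by <:].
HB.instance Definition _ := [SubChoice_isSubComNzRing of symb_rees by <:].

(* The ideal m R_s(I) of R_s(I), generated by the constants lying in m *)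
Definition fiber_ideal : set symb_rees :=
  ideal_gen [set r | exists2 f, irrelevant_ideal f & val r = f%:P].

Definition fiber_pred : {pred symb_rees} := fun r => `[< fiber_ideal r >].

Lemma fiber_idealr_closed : idealr_closed fiber_pred.
Proof.
have [f0 fD fM] := ideal_gen_ideal
  [set r : symb_rees | exists2 f, irrelevant_ideal f & val r = f%:P].
split; first exact/asboolP.
  apply/negP => /asboolP F1.
  pose ev (p : mpoly n k) := meval (fun _ => 0) p.
  have evI f : irrelevant_ideal f -> ev f = 0.
    apply: (@smallest_sub _ _ _ [set f | ev f = 0]).
      split=> [|x y /= x0 y0|a x /= x0].
      - by rewrite /= /ev meval0.
      - by rewrite /= /ev mevalD [meval _ x]x0 [meval _ y]y0 addr0.
      - by rewrite /= /ev mevalM [meval _ x]x0 mulr0.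
    by move=> _ [i _ <-] /=; rewrite /ev mevalXU.
  have : ev (val (1 : symb_rees))`_0 = 0.
    apply: (@smallest_sub _ _ _ [set r : symb_rees | ev (val r)`_0 = 0] _ _ _ F1).
      split=> [|x y /= x0 y0|a x /= x0].
      - by rewrite /= coef0 /ev meval0.
      - have e : (val (x + y))`_0 = (val x)`_0 + (val y)`_0 by exact: coefD.
        by rewrite /= e /ev mevalD [meval _ _]x0 [meval _ _]y0 addr0.
      - have e : (val (a * x))`_0 = (val a)`_0 * (val x)`_0 by exact: coef0M.
        by rewrite /= e /ev mevalM [X in _ * X]x0 mulr0.
    by move=> r [f If /= ->]; rewrite coefC /=; exact: evI.
  by rewrite /ev coef1 /= meval1 => /eqP; rewrite oner_eq0.
by move=> a u v /asboolP Fu /asboolP Fv; apply/asboolP; apply: fD => //; exact: fM.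
Qed.

HB.instance Definition _ := isIdealr.Build symb_rees fiber_pred fiber_idealr_closed.

(* R_s(I) / m R_s(I) *)
Definition symb_fiber : comNzRingType := {ideal_quot fiber_pred}.

Definition is_symb_spread (l : nat) := krull_dim symb_fiber l.

End SymbolicRees.

Section Polyhedra.
Variables (R : realType) (n : nat).
Implicit Types (P F : set 'rV[R]_n).

Definition dot (a x : 'rV[R]_n) : R := \sum_(i < n) a 0 i * x 0 i.

Definition convex_hull (S : set 'rV[R]_n) : set 'rV[R]_n :=
  smallest (@convex_set R 'rV[R]_n) S.

(* F is a nonempty face of P (a = 0, b = 0 gives P itself) *)
Definition is_face P F :=
  F !=set0 /\
  exists (a : 'rV[R]_n) (b : R),
    (forall x, P x -> b <= dot a x) /\ F = P `&` [set x | dot a x = b].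

Definition is_vertex P (v : 'rV[R]_n) := is_face P [set v].

(* x + U is the affine hull of F *)
Definition affine_dim F (d : nat) :=
  exists2 x, F x & exists U : {vspace 'rV[R]_n},
    [/\ \dim U = d, forall y, F y -> y - x \in U &
        forall V : {vspace 'rV[R]_n},
          (forall y, F y -> y - x \in V) -> (U <= V)%VS].

Definition is_mdc P (m : nat) :=
  (exists F, [/\ is_face P F, compact F & affine_dim F m]) /\
  (forall F d, is_face P F -> compact F -> affine_dim F d -> (d <= m)%N).

(* 0 for irrational numbers *)
Definition denominator (x : R) : nat :=
  if pselect (exists q : rat, x = ratr q) is left h
  then `|denq (projT1 (cid h))|%N else 0%N.

Definition lcm_denominators (vs : seq 'rV[R]_n) : nat :=
  \big[lcmn/1%N]_(v <- vs) \big[lcmn/1%N]_(i < n) denominator (v 0 i).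

End Polyhedra.

Section NewtonPolyhedron.
Variables (R : realType) (k : fieldType) (n : nat).
Implicit Types (I : set (mpoly n k)).

Definition newton_polyhedron I : set 'rV[R]_n :=
  convex_hull [set \row_(i < n) (m i)%:R | m in [set m : multinom n | I (mpolyX k m)]].

Definition symbolic_polyhedron I : set 'rV[R]_n :=
  \bigcap_(P in max_assoc_prime I) newton_polyhedron (contract_at I P).

End NewtonPolyhedron.

Arguments newton_polyhedron R {k n} I.
Arguments symbolic_polyhedron R {k n} I.

(* Main.v *)
(* The minimal primes of I are generated by sets F of variables, so I^(e) is spanned by the
   monomials x^m with m(F) >= e b(F) for all F, where m(F) is the sum of the m_i over F, and
   SP(I) is the polyhedron P of all x >= 0 with x(F) >= b(F).

   If I^(dk) = (I^(d))^k for all k and v is a vertex of P, then a suitable multiple N d v is a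
   sum of N lattice points of d P; dividing by N d exhibits v as a mean of points of P, which
   must all be v, so d v is integral. Conversely, every point of P lies above a point of a
   compact face, hence above a convex combination of at most mdc(P) + 1 vertices; rounding
   the coefficients down writes a lattice point of k mdc(P) c P as a sum of enough vertices of
   c P and a lattice point of a small multiple of c P.

   For the Krull dimension of the symbolic fiber: the exponents of the monomials outside a
   prime of the fiber lie over one compact face, so modulo this prime the monomials of degree
   at most D number O(D^(mdc(P) + 1)). A chain of primes of length e yields e elements that
   are algebraically independent modulo its smallest prime, hence N^e independent products of
   degree O(N), and e <= mdc(P) + 1. A chain of this length is obtained from a compact face of
   maximal dimension by sending to 0 the monomials outside the cone over the face and to 1 the
   variables outside an independent set of coordinates that loses one element at each step,
   and finally t to 1. *)

Require Import Defs.
Set Warnings "-all".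
From HB Require Import structures.
From mathcomp Require Import all_boot all_order all_algebra.
From mathcomp Require Import boolp classical_sets reals topology normedtype convex.
From mathcomp Require Import interval_inference.
From mathcomp Require Import zify ring lra.
From mathcomp Require Import -(notations) mpoly.

Set Implicit Arguments.
Unset Strict Implicit.
Unset Printing Implicit Defensive.

Import Order.TTheory GRing.Theory Num.Theory.
Import numFieldNormedType.Exports.

Local Open Scope classical_set_scope.
Local Open Scope ring_scope.

(** * Monomial ideals *)

Section MonomialIdeals.
Variables (k : fieldType) (n : nat).
Implicit Types (p q f g : mpoly n k) (m : multinom n) (U V : set (multinom n)).
Implicit Type F : {set 'I_n}.

Definition mono_span U : set (mpoly n k) :=
  [set p | forall m, m \in msupp p -> U m].

Definition up_closed U := forall m m', U m -> U (mnm_add m m').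

Definition sumset U V : set (multinom n) :=
  [set m | exists u v, [/\ U u, V v & m = mnm_add u v]].

(* Like [ideal_pow], the zeroth power is everything. *)
Definition sumset_pow U (e : nat) : set (multinom n) := iter e (sumset U) setT.

Lemma mono_spanX U m : mono_span U (mpolyX k m) <-> U m.
Proof.
split=> [/(_ m)|Um m']; rewrite msuppX mem_seq1 ?eqxx; first by apply.
by move=> /eqP ->.
Qed.

Lemma mono_span_inj U V : mono_span U = mono_span V -> U = V.
Proof. by move=> e; apply/seteqP; split=> m /mono_spanX; rewrite (e, esym e) => /mono_spanX. Qed.

Lemma mono_span_ideal U : up_closed U -> is_ideal (mono_span U).
Proof.
move=> upU; split=> [m|p q Up Uq m|a p Up m].
- by rewrite msupp0.
- by move/msuppD_le; rewrite mem_cat => /orP[/Up|/Uq].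
- case/msuppM_le/allpairsP=> -[m1 m2] /= [_ m2p ->].
  by rewrite addmC; apply: upU; exact: Up.
Qed.

Lemma ideal_sum (A : comNzRingType) (J : set A) (T : eqType) (r : seq T) (F : T -> A) :
  is_ideal J -> (forall i, i \in r -> J (F i)) -> J (\sum_(i <- r) F i).
Proof.
move=> [J0 JD _] JF; rewrite big_seq; apply: (big_ind J) => //.
Qed.

Lemma mono_span_sub_ideal (J : set (mpoly n k)) U :
  is_ideal J -> (forall m, U m -> J (mpolyX k m)) -> mono_span U `<=` J.
Proof.
move=> idJ JU p Up; rewrite (mpolyE p); apply: ideal_sum => // m mp.
by have [_ _ JM] := idJ; rewrite -mul_mpolyC; apply: JM; apply/JU/Up.
Qed.

Lemma ideal_gen_min (A : comNzRingType) (J S : set A) :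
  is_ideal J -> S `<=` J -> ideal_gen S `<=` J.
Proof. by move=> idJ SJ; exact: smallest_sub. Qed.

Lemma ideal_gen_monomials (S : set (multinom n)) :
  ideal_gen [set mpolyX k m | m in S] =
  mono_span [set m | exists2 s, S s & exists m', m = mnm_add s m'].
Proof.
apply/seteqP; split.
  apply: ideal_gen_min => [|_ [m Sm <-]].
    apply: mono_span_ideal => m m' [s Ss [m'' ->]].
    by exists s => //; exists (mnm_add m'' m'); rewrite addmA.
  by apply/mono_spanX; exists m => //; exists mnm0; rewrite addm0.
apply: mono_span_sub_ideal => [|m [s Ss [m' ->]]]; first exact: ideal_gen_ideal.
rewrite mpolyXD mulrC; have [_ _] := ideal_gen_ideal [set mpolyX k m | m in S].
by apply; apply: sub_gen_smallest; exists s.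
Qed.

Lemma sumset_up U V : up_closed U -> up_closed (sumset U V).
Proof.
move=> upU m m' [u [v [Uu Vv ->]]].
exists (mnm_add u m'), v; split=> //; first exact: upU.
by rewrite -!addmA [mnm_add v _]addmC.
Qed.

Lemma sumset_pow_up U e : up_closed U -> up_closed (sumset_pow U e).
Proof. by case: e => [|e] upU //; exact: sumset_up. Qed.

Lemma ideal_mul_mono_span U V : up_closed U ->
  ideal_mul (mono_span U) (mono_span V) = mono_span (sumset U V).
Proof.
move=> upU; apply/seteqP; split.
  apply: ideal_gen_min => [|_ [p Up [q Vq <-]] m].
    exact/mono_span_ideal/sumset_up.
  case/msuppM_le/allpairsP=> -[m1 m2] /= [m1p m2q ->].
  by exists m1, m2; split; [exact: Up|exact: Vq|].
apply: mono_span_sub_ideal => [|m [u [v [Uu Vv ->]]]]; first exact: ideal_gen_ideal.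
apply: sub_gen_smallest; exists (mpolyX k u); first exact/mono_spanX.
by exists (mpolyX k v); [exact/mono_spanX|rewrite mpolyXD].
Qed.

Lemma ideal_pow_mono_span U e : up_closed U ->
  ideal_pow (mono_span U) e = mono_span (sumset_pow U e).
Proof.
move=> upU; elim: e => [|e IHe];
  last by rewrite /ideal_pow iterS -/(ideal_pow _ e) IHe ideal_mul_mono_span.
by apply/seteqP; split.
Qed.

Definition degs (F : {set 'I_n}) m : nat := \sum_(i in F) m i.

Lemma degsD F m m' : degs F (mnm_add m m') = (degs F m + degs F m')%N.
Proof. by rewrite /degs -big_split; apply: eq_bigr => i _; rewrite mnmDE. Qed.

Lemma degs0 F : degs F mnm0 = 0%N.
Proof. by rewrite /degs big1 // => i _; rewrite mnm0E. Qed.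

Lemma degs_muln F m e : degs F (mnm_muln m e) = (degs F m * e)%N.
Proof. by rewrite /degs big_distrl; apply: eq_bigr => i _; rewrite mulmnE. Qed.

Lemma degs1 F i : degs F (mnm1 i) = (i \in F).
Proof.
rewrite /degs; case: (boolP (i \in F)) => iF.
  rewrite (bigD1 i) //= big1 ?mnm1E ?eqxx // => j /andP[_ /negbTE ji].
  by rewrite mnm1E eq_sym ji.
by rewrite big1 // => j jF; rewrite mnm1E; case: eqP iF => // ->; rewrite jF.
Qed.

Lemma degs_eq0 F m : (degs F m == 0%N) = [forall i in F, m i == 0%N].
Proof. by rewrite /degs sum_nat_eq0; apply: eq_forallb => i. Qed.

Lemma degs_gt0P F m : reflect (exists2 i, i \in F & (0 < m i)%N) (0 < degs F m)%N.
Proof.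
rewrite lt0n degs_eq0 negb_forall_in; apply: (iffP exists_inP) => -[i iF].
  by rewrite -lt0n; exists i.
by rewrite lt0n; exists i.
Qed.

(* Peeling off one variable of [F] at a time. *)
Lemma sumset_pow_degs F e :
  sumset_pow [set m | (0 < degs F m)%N] e = [set m | (e <= degs F m)%N].
Proof.
elim: e => [|e IHe]; first by apply/seteqP; split.
rewrite /sumset_pow iterS -/(sumset_pow _ e) IHe; apply/seteqP; split=> m /=.
  by case=> u [v [/= Fu Fv ->]]; rewrite degsD -add1n leq_add.
move=> Fm; have /degs_gt0P[i iF mi] : (0 < degs F m)%N by exact: leq_trans Fm.
have mE : m = mnm_add (mnm1 i) (mnm_sub m (mnm1 i)).
  by rewrite addmC submK // lep1mP -lt0n.
exists (mnm1 i), (mnm_sub m (mnm1 i)); split=> //=; first by rewrite degs1 iF.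
by move: Fm; rewrite [in degs F m]mE degsD degs1 iF add1n ltnS.
Qed.

Lemma degs_ge_up F e : up_closed [set m | (e <= degs F m)%N].
Proof. by move=> m m' /= h; rewrite degsD (leq_trans h) // leq_addr. Qed.

Definition mono_prime (F : {set 'I_n}) : set (mpoly n k) :=
  mono_span [set m | (0 < degs F m)%N].

Lemma mono_prime_pow F e :
  ideal_pow (mono_prime F) e = mono_span [set m | (e <= degs F m)%N].
Proof. by rewrite ideal_pow_mono_span ?sumset_pow_degs //; exact: degs_ge_up. Qed.

(* The grading by the weights [d], as x_i |-> x_i z^(d_i). Locked, since unification would
   otherwise unfold [mmap] when it compares two values. *)
Definition weight_map (d : 'I_n -> nat) : mpoly n k -> {poly mpoly n k} :=
  locked (mmap (polyC \o @mpolyC n k) (fun i => (mpolyX k (mnm1 i))%:P * 'X^(d i))).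

Lemma weight_map_zmod_morphism d : zmod_morphism (weight_map d).
Proof. by rewrite /weight_map -lock; exact: raddfB. Qed.

Lemma weight_map_monoid_morphism d : monoid_morphism (weight_map d).
Proof. by rewrite /weight_map -lock; split; [exact: rmorph1|exact: rmorphM]. Qed.

HB.instance Definition _ d :=
  GRing.isZmodMorphism.Build _ _ (weight_map d) (weight_map_zmod_morphism d).
HB.instance Definition _ d :=
  GRing.isMonoidMorphism.Build _ _ (weight_map d) (weight_map_monoid_morphism d).

Definition wdeg (d : 'I_n -> nat) m := (\sum_i d i * m i)%N.

Lemma weight_mapX d m :
  weight_map d (mpolyX k m) = (mpolyX k m)%:P * 'X^(wdeg d m).
Proof.
rewrite /weight_map -lock mmapX /mmap1 [in RHS]mpolyXE_id rmorph_prod /wdeg.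
rewrite expr_sum -big_split; apply: eq_bigr => i _ /=.
by rewrite exprMn rmorphXn /= exprM.
Qed.

Lemma weight_mapE d p :
  weight_map d p = \sum_(m <- msupp p) (mcoeff m p *: mpolyX k m) *: 'X^(wdeg d m).
Proof.
rewrite [in LHS](mpolyE p) rmorph_sum; apply: eq_bigr => m _.
rewrite -mul_mpolyC rmorphM /= weight_mapX {1}/weight_map -lock mmapC /=.
by rewrite -mul_polyC polyCM mulrA.
Qed.

Lemma coef_weight_map d p e m :
  mcoeff m (weight_map d p)`_e = if wdeg d m == e then mcoeff m p else 0.
Proof.
rewrite weight_mapE coef_sum raddf_sum /=.
rewrite (eq_bigr (fun m' => (mcoeff m' p * (m' == m)%:R) * (e == wdeg d m')%:R)); last first.
  move=> m' _; rewrite coefZ coefXn mulr_natr.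
  case: eqP => _; last by rewrite !mulr0n raddf0 mulr0.
  by rewrite !mulr1n mcoeffZ mcoeffX mulr1.
case: (boolP (m \in msupp p)) => [mp|mp].
  rewrite (bigD1_seq m) ?msupp_uniq //= big1 ?addr0 => [|m' /negbTE ->]; last first.
    by rewrite mulr0 mul0r.
  by rewrite eqxx mulr1 eq_sym; case: eqP; rewrite ?mulr1 ?mulr0.
rewrite big_seq big1 => [|m' m'p]; last first.
  by case: eqP => [e'|]; [rewrite -e' m'p in mp|rewrite mulr0 mul0r].
by rewrite (memN_msupp_eq0 mp); case: ifP.
Qed.

Definition setw (F : {set 'I_n}) (i : 'I_n) : nat := (i \in F).

Lemma wdeg_setw F m : wdeg (setw F) m = degs F m.
Proof.
by rewrite /wdeg /degs [RHS]big_mkcond; apply: eq_bigr => i _; rewrite /setw; case: (i \in F);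
  rewrite ?mul1n.
Qed.

(** Membership in a power of a monomial prime is thus a lower bound on the order in z, so that
    statements about these ideals become statements about polynomials in one variable over a
    domain. *)
Lemma weight_map_lt F e p :
  mono_span [set m | (e <= degs F m)%N] p <->
  forall j, (j < e)%N -> (weight_map (setw F) p)`_j = 0.
Proof.
split=> [Fp j je|h m mp /=].
  apply/mpolyP => m; rewrite coef_weight_map mcoeff0 wdeg_setw; case: eqP => // mj.
  apply: memN_msupp_eq0; apply/negP => /Fp /=; rewrite mj leqNgt je //.
rewrite leqNgt; apply/negP => /h /(congr1 (mcoeff m)).
by rewrite coef_weight_map wdeg_setw eqxx mcoeff0 => /eqP; rewrite mcoeff_eq0 mp.
Qed.

Lemma low_coef_cancel (D : idomainType) (P Q : {poly D}) (e : nat) :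
  P`_0 != 0 -> (forall j, (j < e)%N -> (P * Q)`_j = 0) ->
  forall j, (j < e)%N -> Q`_j = 0.
Proof.
move=> P0 PQ; elim/ltn_ind => j IHj je.
move: (PQ j je); rewrite coefM big_ord_recl /= subn0 big1 ?addr0.
  by move/eqP; rewrite mulf_eq0 (negbTE P0) => /eqP.
move=> i _; have ij : (j - lift ord0 i < j)%N by rewrite lift0; have := ltn_ord i; lia.
by rewrite (IHj _ ij (ltn_trans ij je)) mulr0.
Qed.

(** Powers of monomial primes are primary: for g outside the prime, [weight_map] sends g to a
    polynomial with nonzero constant coefficient, so g f and f have the same order in z. *)
Lemma mono_prime_primary F e g f :
  ~ mono_prime F g -> mono_span [set m | (e <= degs F m)%N] (g * f) ->
  mono_span [set m | (e <= degs F m)%N] f.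
Proof.
move=> Fg /weight_map_lt gf; apply/weight_map_lt.
apply: (@low_coef_cancel _ (weight_map (setw F) g)).
  by apply/eqP => g0; apply: Fg; apply/weight_map_lt => -[].
by move=> j je; rewrite -rmorphM; exact: gf.
Qed.

Lemma mono_prime_prime F : prime_ideal (mono_prime F).
Proof.
split; first by apply: mono_span_ideal; exact: degs_ge_up.
  by move=> /(_ mnm0); rewrite -mpolyC1 msuppC oner_eq0 mem_seq1 eqxx /= degs0 => /(_ isT).
move=> x y Fxy; case: (pselect (mono_prime F x)) => [|Fx]; [by left|right].
exact: (mono_prime_primary Fx Fxy).
Qed.

Lemma mono_prime_sub F F' : mono_prime F `<=` mono_prime F' <-> F \subset F'.
Proof.
split=> [h|/fintype.subsetP FF']; last first.
  by move=> p Fp m /Fp /= /degs_gt0P[i /FF' iF mi]; apply/degs_gt0P; exists i.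
apply/fintype.subsetP => i iF; have /h/mono_spanX/= : mono_prime F (mpolyX k (mnm1 i)).
  by apply/mono_spanX => /=; rewrite degs1 iF.
by rewrite degs1; case: (i \in F').
Qed.

Lemma mono_prime_inj : injective mono_prime.
Proof. by move=> F F' e; apply/eqP; rewrite finset.eqEsubset; apply/andP; split;
  apply/mono_prime_sub; rewrite e. Qed.

Lemma prime_ideal_prod (A : comNzRingType) (P : set A) (T : eqType) (r : seq T) (F : T -> A) :
  prime_ideal P -> P (\prod_(i <- r) F i) -> exists2 i, i \in r & P (F i).
Proof.
move=> [_ P1 PM]; elim: r => [|i r IHr]; first by rewrite big_nil.
rewrite big_cons => /PM[Pi|/IHr[j jr Pj]]; first by exists i; rewrite ?mem_head.
by exists j => //; rewrite in_cons jr orbT.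
Qed.

Lemma prime_idealX (A : comNzRingType) (P : set A) x e : prime_ideal P -> P (x ^+ e) -> P x.
Proof.
move=> [_ P1 PM]; elim: e => [|e IHe]; first by rewrite expr0.
by rewrite exprS => /PM[].
Qed.

(* The variables in a prime containing a monomial ideal generate a smaller such prime. *)
Lemma min_prime_mono U P : up_closed U -> min_prime (mono_span U) P ->
  exists F, P = mono_prime F.
Proof.
move=> upU [pP UP minP]; pose F := finset (fun i : 'I_n => `[< P (mpolyX k (mnm1 i)) >]).
exists F; apply/esym/minP; first exact: mono_prime_prime.
- move=> p Up m mp; have Um := Up m mp.
  have : P (mpolyX k m) by apply/UP/mono_spanX.
  rewrite mpolyXE_id => /(prime_ideal_prod pP)[i _].
  case: (posnP (m i)) => [->|mi]; first by rewrite expr0; case: pP.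
  by move/(prime_idealX pP) => Pi; apply/degs_gt0P; exists i => //; rewrite inE; exact/asboolP.
apply: mono_span_sub_ideal => [|m /= /degs_gt0P[i]]; first by case: pP.
rewrite inE => /asboolP Pi mi; have -> : m = mnm_add (mnm_sub m (mnm1 i)) (mnm1 i).
  by rewrite submK // lep1mP -lt0n.
by rewrite mpolyXD; have [[_ _ +] _ _] := pP; apply.
Qed.

End MonomialIdeals.

(** * Symbolic powers of ideals of linear-power type *)

Section LinearPowerType.
Variables (k : fieldType) (n : nat).
Implicit Types (I : set (mpoly n k)) (m : multinom n) (b : {set 'I_n} -> nat).
Implicit Type F : {set 'I_n}.

(* The exponents of the monomials of the symbolic power [I^(e)], where [b F] is the
   exponent of the prime generated by the variables in [F], and 0 for the sets [F]
   that do not come from a minimal prime. *)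
Definition symb_exps b (e : nat) : set (multinom n) :=
  [set m | forall F, (e * b F <= degs F m)%N].

(** The sets with positive bound are those of the minimal primes. The empty set stands for the zero
    prime; all its positive powers are 0, so its exponent is normalized to 1. Thus [b finset.set0]
    is 1 for the zero ideal, while b vanishes identically for the unit ideal. *)
Definition antichain_bounds b :=
  (b finset.set0 <= 1)%N /\
  forall F F', (0 < b F)%N -> (0 < b F')%N -> F \subset F' -> F = F'.

Lemma symb_exps_up b e : up_closed (symb_exps b e).
Proof. by move=> m m' h F; rewrite degsD (leq_trans (h F)) // leq_addr. Qed.

Lemma linear_power_typeP I : linear_power_type I ->
  exists2 b, antichain_bounds b & I = mono_span (symb_exps b 1).
Proof.
move=> [[S IS] [w [w0 IE]]].
have upI := ideal_gen_monomials k S; rewrite -IS in upI.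
set U := [set m | _] in upI.
have upU : up_closed U.
  by move=> m m' [s Ss [m'' ->]]; exists s => //; exists (mnm_add m'' m'); rewrite addmA.
pose b F := if `[< min_prime I (@mono_prime k n F) >]
  then (if F == finset.set0 then 1%N else w (mono_prime F)) else 0%N.
exists b.
  split; first by rewrite /b eqxx; case: ifP.
  move=> F F'; rewrite /b; case: asboolP => // -[pF IF minF] _.
  case: asboolP => // -[pF' IF' minF'] _ FF'.
  apply/(@mono_prime_inj k)/minF' => //; exact/mono_prime_sub.
have bE F (p : mpoly n k) : min_prime I (mono_prime F) ->
    ideal_pow (mono_prime F) (w (mono_prime F)) p <->
    mono_span [set m | (b F <= degs F m)%N] p.
  move=> mF; rewrite mono_prime_pow /b; case: asboolP => // _; case: eqP => // F0.
  have wF := w0 _ mF; split=> h m /h /=; rewrite F0 /degs big_set0.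
    by rewrite leqNgt; rewrite F0 in wF; rewrite wF.
  by [].
apply/seteqP; split=> [p Ip m mp F|p Ap].
  rewrite mul1n; case: (pselect (min_prime I (@mono_prime k n F))) => mF; last first.
    by rewrite /b; case: asboolP.
  rewrite IE in Ip; exact: (bE F p mF).1 (Ip _ mF) m mp.
rewrite IE => P mP; have [F PE] : exists F, P = mono_prime F.
  by apply: (min_prime_mono upU); rewrite -upI.
rewrite PE in mP *; apply/(bE F p mP) => m /Ap /(_ F).
by rewrite mul1n.
Qed.

Lemma degs_split F a c m : (a + c <= degs F m)%N ->
  exists u v, [/\ m = mnm_add u v, degs F u = a & (c <= degs F v)%N].
Proof.
elim: a m => [|a IHa] m h; first by exists mnm0, m; rewrite add0m degs0.
have /degs_gt0P[i iF mi] : (0 < degs F m)%N by apply: leq_trans h; rewrite addSn.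
have mE : m = mnm_add (mnm1 i) (mnm_sub m (mnm1 i)).
  by rewrite addmC submK // lep1mP -lt0n.
have [|u [v [uv du dv]]] := IHa (mnm_sub m (mnm1 i)).
  by move: h; rewrite [in degs F m]mE degsD degs1 iF; lia.
exists (mnm_add (mnm1 i) u), v; split=> //; last by rewrite degsD degs1 iF du add1n.
by rewrite -addmA -uv.
Qed.

Lemma sumset_pow_sub b d e m : sumset_pow (symb_exps b d) e m -> symb_exps b (d * e) m.
Proof.
elim: e m => [|e IHe] m; first by move=> _ F; rewrite muln0.
move=> [u [v [Au /IHe Av ->]]] F; rewrite degsD mulnS mulnDl.
by apply: leq_add; [exact: Au|exact: Av].
Qed.

Variable b : {set 'I_n} -> nat.
Hypothesis hb : antichain_bounds b.
Let I := mono_span (symb_exps b 1) : set (mpoly n k).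
Let W := (\sum_F b F)%N.

(** This monomial lies outside the prime of F but meets the bound of every other minimal prime: by
    the antichain condition such a prime has a variable outside F, and W dominates all bounds. *)
Let off F : multinom n := Multinom [tuple (if i \in F then 0 else W)%N | i < n].

Let degs_off F : degs F (off F) = 0%N.
Proof. by rewrite /degs big1 // => i iF; rewrite mnmE iF. Qed.

Let degs_off_other F F' : (0 < b F)%N -> F' <> F -> (b F' <= degs F' (off F))%N.
Proof.
move=> bF F'F; case: (posnP (b F')) => [->//|bF'].
have /fintype.subsetPn[i iF' iF] : ~~ (F' \subset F).
  by apply/negP => /(hb.2 F' F bF' bF).
rewrite /degs (bigD1 i) //= mnmE (negbTE iF) (leq_trans _ (leq_addr _ _)) //.
by rewrite /W (bigD1 F') //= leq_addr.
Qed.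

Lemma ideal_pow_symb_exps e : ideal_pow I e = mono_span (sumset_pow (symb_exps b 1) e).
Proof. by rewrite ideal_pow_mono_span //; exact: symb_exps_up. Qed.

(** From left to right, a denominator outside the prime cancels because powers of the prime are
    primary. Conversely, the e-th power of the monomial [off F] is outside the prime and multiplies
    the whole right-hand side into I^e. *)
Lemma contract_pow F e : (0 < b F)%N ->
  contract_at (ideal_pow I e) (mono_prime F) = mono_span [set m | (e * b F <= degs F m)%N].
Proof.
move=> bF; rewrite ideal_pow_symb_exps; apply/seteqP; split=> x.
  move/(contract_atP _ _ (mono_prime_prime k F)) => [s Fs h].
  apply: (mono_prime_primary Fs); rewrite mulrC => m /h /sumset_pow_sub.
  by rewrite mul1n; apply.
move=> Fx; apply/(contract_atP _ _ (mono_prime_prime k F)).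
exists (mpolyX k (mnm_muln (off F) e)).
  by move/mono_spanX; rewrite /= degs_muln degs_off mul0n.
have : mono_span [set m | (e * b F <= degs F m)%N] x by [].
move: x {Fx}; apply: (@mono_span_sub_ideal k n [set x | mono_span _ (x * _)]).
  have [J0 JD JM] := mono_span_ideal k (sumset_pow_up (e := e) (@symb_exps_up b 1)).
  split=> [|x y /= hx hy|a x /= hx]; first by rewrite /= mul0r.
    by rewrite mulrDl; exact: JD.
  by rewrite -mulrA; exact: JM.
move=> m /= Fm; rewrite -mpolyXD; apply/mono_spanX.
(* A piece u with F-degree exactly b F is split off and paired with one copy of [off F]; the two
   together lie in I, and the rest keeps enough degree for the remaining copies. *)
elim: e m Fm => [//|e IHe] m; rewrite mulSn => /degs_split[u [v [-> du dv]]].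
exists (mnm_add u (off F)), (mnm_add v (mnm_muln (off F) e)); split; last 2 first.
- exact: IHe.
- by apply/mnmP => i; rewrite !mnmDE !mulmnE mulnS; lia.
move=> F'; rewrite mul1n degsD; case: (pselect (F' = F)) => [->|F'F].
  by rewrite du leq_addr.
by apply: leq_trans (leq_addl _ _); exact: degs_off_other.
Qed.

Lemma assoc_symb_exps P : assoc_prime I P <-> exists2 F, (0 < b F)%N & P = mono_prime F.
Proof.
split=> [[pP [f PE]]|[F bF ->]]; last first.
  split; first exact: mono_prime_prime.
  (* The exponent u misses the bound of F by exactly one and meets all the others, so the
     annihilator of x^u modulo I is the prime of F. For empty F the normalization b F = 1 makes
     [off F] itself suitable. *)
  have [u du uoff] : exists2 u, degs F u = (b F).-1 & forall F', (degs F' (off F) <= degs F' u)%N.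
    case: (set_0Vmem F) => [F0|[i iF]].
      exists (off F) => //; rewrite F0 /degs big_set0; have := hb.1.
      by rewrite F0 in bF; lia.
    exists (mnm_add (off F) (mnm_muln (mnm1 i) (b F).-1)).
      by rewrite degsD degs_off degs_muln degs1 iF mul1n.
    by move=> F'; rewrite degsD leq_addr.
  exists (mpolyX k u); apply/seteqP; split=> g /= h.
    move=> m; rewrite (perm_mem (msuppMX _ _)) => /mapP[m' m'g ->] F'.
    rewrite mul1n degsD; case: (pselect (F' = F)) => [->|F'F].
      by rewrite du; have := h _ m'g; rewrite /=; lia.
    by apply: leq_trans (leq_addr _ _); apply: leq_trans (uoff _); exact: degs_off_other.
  move=> m mg /=; have /h/(_ F) : mnm_add u m \in msupp (g * mpolyX k u).
    by rewrite (perm_mem (msuppMX _ _)) map_f.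
  by rewrite mul1n degsD du; lia.
pose M F : set (mpoly n k) := mono_span [set m | (b F <= degs F m)%N].
have IM p : I p <-> forall F, (0 < b F)%N -> M F p.
  split=> [h F _ m /h /(_ F)|h m mp F]; first by rewrite mul1n.
  by rewrite mul1n; case: (posnP (b F)) => [->//|/h]; apply.
have MX F g e : M F g -> M F (e * g).
  by have [_ _] := mono_span_ideal k (@degs_ge_up n F (b F)); apply.
(* Otherwise every prime whose component misses f contains an element outside P. The product of
   suitable powers of these elements multiplies f into I, so it lies in P, against primality. *)
have [F [bF Mf FP]] : exists F, [/\ (0 < b F)%N, ~ M F f & mono_prime F `<=` P].
  apply: contrapT => noF.
  have /boolp.choice[g gP] : forall F, exists g : mpoly n k,
      (0 < b F)%N -> ~ M F f -> mono_prime F g /\ ~ P g.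
    move=> F; case: (pselect (mono_prime F `<=` P)) => [FP|nFP].
      by exists 0 => bF Mf; case: noF; exists F.
    have [g Fg Pg] : exists2 g, mono_prime F g & ~ P g.
      apply: contrapT => h; apply: nFP => g Fg; apply: contrapT => Pg.
      by apply: h; exists g.
    by exists g.
  pose D := finset (fun F => `[< (0 < b F)%N /\ ~ M F f >]).
  have : P (\prod_(F <- enum D) g F ^+ b F).
    rewrite PE /=; apply/IM => F bF.
    case: (pselect (M F f)) => [|Mf]; first exact: MX.
    have FD : F \in enum D by rewrite mem_enum inE; apply/asboolP.
    rewrite mulrC; apply: (MX F).
    rewrite (perm_big _ (perm_to_rem FD)) big_cons /= mulrC; apply: (MX F).
    have : ideal_pow (mono_prime F) (b F) (g F ^+ b F).
      have [Fg _] := gP F bF Mf; elim: (b F) => [|e IHe] //.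
      rewrite exprS /ideal_pow iterS; apply: sub_gen_smallest.
      by exists (g F) => //; exists (g F ^+ e).
    by rewrite mono_prime_pow.
  case/(prime_ideal_prod pP) => F; rewrite mem_enum inE => /asboolP[bF Mf].
  by move/(prime_idealX pP); case: (gP F bF Mf).
(* As f is outside the primary component of F, having g f inside forces g into its prime. *)
exists F => //; apply/seteqP; split=> // g; rewrite PE /= => /IM /(_ F bF) gf.
by apply: contrapT => Fg; apply: Mf; exact: (mono_prime_primary Fg gf).
Qed.

Lemma max_assoc_symb_exps P :
  max_assoc_prime I P <-> exists2 F, (0 < b F)%N & P = mono_prime F.
Proof.
split=> [[/assoc_symb_exps//]|[F bF ->]]; split; first by apply/assoc_symb_exps; exists F.
move=> Q /assoc_symb_exps[F' bF' ->] /mono_prime_sub FF'.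
by rewrite (hb.2 _ _ bF bF' FF').
Qed.

Lemma symb_pow_symb_exps e : symb_pow I e = mono_span (symb_exps b e).
Proof.
apply/seteqP; split=> p h.
  move=> m mp F; case: (posnP (b F)) => [->|bF]; first by rewrite muln0.
  have : contract_at (ideal_pow I e) (mono_prime F) p.
    by apply: h; apply/assoc_symb_exps; exists F.
  by rewrite contract_pow //; apply.
move=> P /assoc_symb_exps[F bF ->]; rewrite contract_pow // => m mp.
exact: h.
Qed.

Lemma symb_veronese_exps d : symb_veronese I d <->
  forall e, (0 < e)%N -> symb_exps b (d * e) = sumset_pow (symb_exps b d) e.
Proof.
have E e : symb_pow I (d * e) = ideal_pow (symb_pow I d) e <->
    symb_exps b (d * e) = sumset_pow (symb_exps b d) e.
  rewrite !symb_pow_symb_exps ideal_pow_mono_span; last exact: symb_exps_up.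
  by split=> [/mono_span_inj|->].
by split=> h e /h /E.
Qed.

Lemma contract_mono_prime F : (0 < b F)%N ->
  contract_at I (mono_prime F) = mono_span [set m | (b F <= degs F m)%N].
Proof.
move=> bF; have <- : ideal_pow I 1 = I.
  rewrite ideal_pow_symb_exps; congr mono_span; apply/seteqP; split=> m.
    by move=> [u [v [Au _ ->]]]; exact: symb_exps_up.
  by exists m, mnm0; rewrite addm0.
by rewrite contract_pow // mul1n.
Qed.

End LinearPowerType.

(** * The symbolic polyhedron *)

Section ConvexSets.
Variables (R : realType) (n : nat).
Implicit Types (C : set 'rV[R]_n) (x y z : 'rV[R]_n).
Implicit Type F : {set 'I_n}.

Lemma convex_setP C : @convex_set R 'rV[R]_n C <->
  forall x y t, C x -> C y -> 0 <= t -> t <= 1 -> C (t *: x + (1 - t) *: y).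
Proof.
split=> [cC x y t Cx Cy t0 t1|cC x y t /set_mem Cx /set_mem Cy].
  have := cC x y (Itv01 t0 t1) (mem_set Cx) (mem_set Cy).
  by move/set_mem.
by apply/mem_set; exact: cC.
Qed.

Lemma convex_sum C (T : Type) (r : seq T) (p : pred T) (l : T -> R) (z : T -> 'rV[R]_n) :
  @convex_set R 'rV[R]_n C ->
  (forall i, p i -> 0 <= l i) -> (forall i, p i -> C (z i)) ->
  0 < \sum_(i <- r | p i) l i ->
  C ((\sum_(i <- r | p i) l i)^-1 *: \sum_(i <- r | p i) l i *: z i).
Proof.
move=> /convex_setP cC l0 Cz.
set s := \sum_(i <- r | p i) l i; set w := \sum_(i <- r | p i) _.
(* The first alternative serves in the induction for lists whose weights all vanish, which cannot be
   normalized. *)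
suff : (s = 0 /\ w = 0) \/ (0 < s /\ C (s^-1 *: w)).
  by case=> -[e1 e2] //; rewrite e1 ltxx.
rewrite /s /w; elim: r {s w} => [|i r IHr]; first by left; rewrite !big_nil.
rewrite !big_cons; case: ifP => // pi; move: IHr.
set s := \sum_(j <- r | p j) l j; set w := \sum_(j <- r | p j) _ => IHr.
have [li|li] := eqVneq (l i) 0; first by rewrite li scale0r !add0r.
have {}li : 0 < l i by rewrite lt_def li l0.
right; case: IHr => [[-> ->]|[s0 Cw]].
  by rewrite !addr0 scalerA mulVf ?scale1r ?gt_eqF //; split=> //; exact: Cz.
split; first exact: addr_gt0.
have ls : 0 < l i + s by exact: addr_gt0.
have -> : (l i + s)^-1 *: (l i *: z i + w) =
    (l i / (l i + s)) *: z i + (1 - l i / (l i + s)) *: (s^-1 *: w).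
  rewrite scalerDr !scalerA [in LHS]mulrC; congr (_ + _ *: _).
  by field; rewrite !gt_eqF.
apply: cC => //; [exact: Cz|by apply: divr_ge0; exact: ltW|].
by rewrite ler_pdivrMr // mul1r lerDl ltW.
Qed.

Definition subsum F x : R := \sum_(i in F) x 0 i.

Lemma subsumD F x y : subsum F (x + y) = subsum F x + subsum F y.
Proof. by rewrite /subsum -big_split; apply: eq_bigr => i _; rewrite mxE. Qed.

Lemma subsumZ F a x : subsum F (a *: x) = a * subsum F x.
Proof. by rewrite /subsum mulr_sumr; apply: eq_bigr => i _; rewrite mxE. Qed.

Lemma subsumN F x : subsum F (- x) = - subsum F x.
Proof. by rewrite -scaleN1r subsumZ mulN1r. Qed.

Lemma subsumB F x y : subsum F (x - y) = subsum F x - subsum F y.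
Proof. by rewrite subsumD subsumN. Qed.

Lemma subsum_sum F (T : Type) (r : seq T) (p : pred T) (z : T -> 'rV[R]_n) :
  subsum F (\sum_(i <- r | p i) z i) = \sum_(i <- r | p i) subsum F (z i).
Proof.
elim/big_rec2: _ => [|i y x pi <-]; last by rewrite subsumD.
by rewrite /subsum big1 // => i _; rewrite mxE.
Qed.

Lemma subsum_set1 i x : subsum (finset.set1 i) x = x 0 i.
Proof. by rewrite /subsum big_set1. Qed.

Lemma subsum_nneg F x : (forall i, 0 <= x 0 i) -> 0 <= subsum F x.
Proof. by move=> x0; apply: sumr_ge0. Qed.

Definition mnm_row (m : multinom n) : 'rV[R]_n := \row_i (m i)%:R.

Lemma subsum_mnm_row F m : subsum F (mnm_row m) = (degs F m)%:R.
Proof. by rewrite /subsum /degs natr_sum; apply: eq_bigr => i _; rewrite mxE. Qed.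

(* A point of [z + simplex of size s] is a convex combination of the [z + s e_i]. *)
Lemma convex_simplex C F z x s :
  @convex_set R 'rV[R]_n C -> 0 < s -> subsum F x = s -> (forall i, 0 <= x 0 i) ->
  (forall i, i \in F -> C (z + s *: delta_mx 0 i)) ->
  C (z + \sum_(i in F) x 0 i *: delta_mx 0 i).
Proof.
move=> cC s0 xs x0 Cz.
suff -> : z + \sum_(i in F) x 0 i *: delta_mx 0 i =
    (\sum_(i in F) x 0 i)^-1 *: \sum_(i in F) x 0 i *: (z + s *: delta_mx 0 i).
  by apply: convex_sum => //; rewrite -/(subsum F x) xs.
rewrite [X in _ *: X](eq_bigr (fun i => x 0 i *: z + s *: (x 0 i *: delta_mx 0 i))); last first.
  by move=> i _; rewrite scalerDr !scalerA [s * _]mulrC.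
rewrite big_split /= -scaler_suml -scaler_sumr -/(subsum F x) xs.
by rewrite scalerDr !scalerA mulVf ?gt_eqF // !scale1r.
Qed.

(** For the inclusion from right to left, the hull absorbs first rays, then whole orthants based at
    its lattice points. A point x is then split into a part of F-sum exactly w, which is a convex
    combination of the points w e_i with i in F, and a nonnegative rest z. *)
Lemma newton_polyhedron_degs (k : fieldType) F (w : nat) : (0 < w)%N ->
  newton_polyhedron R (@mono_span k n [set m | (w <= degs F m)%N]) =
  [set x : 'rV[R]_n | (forall i, 0 <= x 0 i) /\ w%:R <= subsum F x].
Proof.
move=> w0; apply/seteqP; split.
  apply: smallest_sub => [|_ [m /mono_spanX /= wm <-]] /=; last first.
    split=> [i|]; first by rewrite mxE.
    by rewrite -/(mnm_row m) subsum_mnm_row ler_nat.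
  apply/convex_setP => x y t [x0 wx] [y0 wy] t0 t1; have t1' : 0 <= 1 - t by rewrite subr_ge0.
  split=> [i|]; first by rewrite !mxE addr_ge0 // mulr_ge0.
  rewrite subsumD !subsumZ -[w%:R](addrNK (t * w%:R)) addrC lerD ?ler_wpM2l //.
  by rewrite -{1}[w%:R]mul1r -mulrBl ler_wpM2l.
move=> x [x0 wx] C [/= cC CS].
have CM m : (w <= degs F m)%N -> C (mnm_row m) by move=> wm; apply: CS; exists m => //;
  exact/mono_spanX.
(* A point of a ray lies on the segment from its origin to a lattice point N steps further, with N >
   a. *)
have rayC m i a : (w <= degs F m)%N -> 0 <= a -> C (mnm_row m + a *: delta_mx 0 i).
  move=> wm a0; have [N Na] : exists N : nat, a < N%:R by exists (Num.bound a); exact: archi_boundP.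
  have N0 : 0 < N%:R :> R by exact: le_lt_trans Na.
  have -> : mnm_row m + a *: delta_mx 0 i = (a / N%:R) *: mnm_row (mnm_add m (mnm_muln (mnm1 i) N))
     + (1 - a / N%:R) *: mnm_row m.
    apply/rowP => j; rewrite !mxE mnmDE mulmnE mnm1E eqxx natrD natrM /= eq_sym.
    by field; rewrite gt_eqF.
  move/convex_setP: cC; apply; [apply: CM|exact: CM|by rewrite divr_ge0 // ltW|].
    by rewrite degsD (leq_trans wm) // leq_addr.
  by rewrite ler_pdivrMr // mul1r ltW.
have orthC m y : (w <= degs F m)%N -> (forall i, 0 <= y 0 i) -> C (mnm_row m + y).
  move=> wm y0; have [s0|s0] := eqVneq (subsum finset.setT y) 0.
    suff -> : y = 0 by rewrite addr0; exact: CM.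
    apply/rowP => i; rewrite mxE; move/eqP: s0; rewrite /subsum psumr_eq0 //.
    by move/allP/(_ i); rewrite mem_index_enum inE => /(_ isT)/eqP.
  have -> : y = \sum_(i in finset.setT) y 0 i *: delta_mx 0 i.
    by rewrite {1}[y]row_sum_delta; apply: eq_bigl => i; rewrite inE.
  apply: (convex_simplex cC (s := subsum finset.setT y)) => // [|i _].
    by rewrite lt_def s0 subsum_nneg.
  by apply: rayC => //; exact: subsum_nneg.
set s := subsum F x in wx; have wR : 0 < w%:R :> R by rewrite ltr0n.
have s0 : 0 < s by exact: lt_le_trans wx.
have ws : w%:R / s <= 1 by rewrite ler_pdivrMr // mul1r.
pose z : 'rV[R]_n := \row_i (if i \in F then (1 - w%:R / s) * x 0 i else x 0 i).
have -> : x = z + \sum_(i in F) ((w%:R / s) *: x) 0 i *: delta_mx 0 i.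
  rewrite {1}[x]row_sum_delta; apply/rowP => j; rewrite !mxE !summxE.
  rewrite (bigD1 j) //= big1 ?addr0 => [|i /negbTE ij]; last by rewrite !mxE eq_sym ij mulr0.
  rewrite !mxE !eqxx mulr1; case: ifP => jF; last first.
    rewrite big1 ?addr0 // => i iF; have ij : (j == i) = false by apply: contraFF jF => /eqP ->.
    by rewrite !mxE ij andbF mulr0.
  rewrite (bigD1 j) //= big1 ?addr0 => [|i /andP[_ /negbTE ij]];
    last by rewrite !mxE eq_sym ij mulr0.
  by rewrite !mxE !eqxx mulr1 -mulrDl subrK mul1r.
apply: (convex_simplex cC wR).
- by rewrite subsumZ -/s mulfVK // gt_eqF.
- by move=> i; rewrite mxE mulr_ge0 // divr_ge0 // ltW.
move=> i iF; have -> : w%:R *: delta_mx 0 i = mnm_row (mnm_muln (mnm1 i) w).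
  by apply/rowP => j; rewrite !mxE mulmnE mnm1E natrM mulrC eqxx eq_sym.
rewrite addrC; apply: orthC; first by rewrite degs_muln degs1 iF mul1n.
by move=> j; rewrite mxE; case: ifP => // _; rewrite mulr_ge0 // subr_ge0.
Qed.

(* The singletons [F] give the inequalities 0 <= x_i, also when [b F] is 0. *)
Definition polyh (b : {set 'I_n} -> nat) : set 'rV[R]_n :=
  [set x | forall F, (b F)%:R <= subsum F x].

Lemma polyh_nneg b x i : polyh b x -> 0 <= x 0 i.
Proof. by move=> /(_ (finset.set1 i)); rewrite subsum_set1; apply: le_trans. Qed.

(** The set F0 guarantees one Newton polyhedron in the intersection, which supplies the inequalities
    x_i >= 0. For the unit ideal the intersection is empty and gives the whole space. *)
Lemma symbolic_polyhedronE (k : fieldType) (b : {set 'I_n} -> nat) F0 :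
  antichain_bounds b -> (0 < b F0)%N ->
  symbolic_polyhedron R (@mono_span k n (symb_exps b 1)) = polyh b.
Proof.
move=> hb bF0; apply/seteqP; split=> x.
  move=> h; have xP F : (0 < b F)%N -> (forall i, 0 <= x 0 i) /\ (b F)%:R <= subsum F x.
    move=> bF; have : max_assoc_prime (@mono_span k n (symb_exps b 1)) (mono_prime F).
      by apply: (max_assoc_symb_exps hb _).2; exists F.
    by move/h; rewrite contract_mono_prime // newton_polyhedron_degs.
  move=> F; case: (posnP (b F)) => [->|/xP[]//].
  by apply: subsum_nneg; case: (xP _ bF0).
move=> Px P PM; have [F bF ->] := (max_assoc_symb_exps hb P).1 PM.
rewrite contract_mono_prime // newton_polyhedron_degs //; split=> // i.
exact: polyh_nneg Px.
Qed.

Lemma symbolic_polyhedron_setT (k : fieldType) (b : {set 'I_n} -> nat) :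
  antichain_bounds b -> (forall F, b F = 0%N) ->
  symbolic_polyhedron R (@mono_span k n (symb_exps b 1)) = setT.
Proof.
move=> hb b0; apply/seteqP; split=> // x _ P.
by move=> PM; have [F] := (max_assoc_symb_exps hb P).1 PM; rewrite b0.
Qed.

End ConvexSets.

(** * Vertices and faces *)

Section Polyhedron.
Variables (R : realType) (n : nat) (b : {set 'I_n} -> nat).
Implicit Types (x y z q u v : 'rV[R]_n) (T : {set {set 'I_n}}).
Implicit Type F : {set 'I_n}.

(** There is a column for every subset, zero outside T, so that the shape does not depend on T. The
    field is a parameter because the same 0-1 matrix over the rationals shows that vertices are
    rational. *)
Definition tight_mx (K : fieldType) T : 'M[K]_(n, #|{set 'I_n}|) :=
  \matrix_(i, j) ((enum_val j \in T) && (i \in enum_val j))%:R.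

Lemma tight_mxP u T : u *m tight_mx R T = 0 <-> {in T, forall F, subsum F u = 0}.
Proof.
have E j : (u *m tight_mx R T) 0 j = if enum_val j \in T then subsum (enum_val j) u else 0.
  rewrite mxE; case: ifP => jT; last by rewrite big1 // => i _; rewrite mxE jT mulr0.
  rewrite /subsum [RHS]big_mkcond; apply: eq_bigr => i _; rewrite mxE jT /=.
  by case: ifP; rewrite ?mulr1 ?mulr0.
split=> [u0 F FT|uT]; last first.
  by apply/rowP => j; rewrite E mxE; case: ifP => // /uT.
by have := E (enum_rank F); rewrite enum_rankK FT u0 mxE => ->.
Qed.

Lemma tight_mx_rat T : map_mx (ratr : rat -> R) (tight_mx rat T) = tight_mx R T.
Proof. by apply/matrixP => i j; rewrite !mxE ratr_nat. Qed.

(* The dimension of the face on which exactly the inequalities of [T] are tight. *)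
Definition corank T := \rank (kermx (tight_mx R T)).

Lemma corank_lt T T' u F : T \subset T' -> {in T, forall F, subsum F u = 0} ->
  F \in T' -> subsum F u != 0 -> (corank T' < corank T)%N.
Proof.
move=> TT' uT FT' uF; apply: rank_ltmx; rewrite ltmxE; apply/andP; split.
  move/fintype.subsetP: TT' => TT'.
  apply/row_subP => i; apply/sub_kermxP/tight_mxP => F' /TT'.
  by move: F'; apply/tight_mxP; rewrite -row_mul mulmx_ker row0.
apply/negP => /(submx_trans _) h; have /h/sub_kermxP/tight_mxP/(_ F FT')/eqP :
  (u <= kermx (tight_mx R T))%MS.
  exact/sub_kermxP/tight_mxP.
by rewrite (negbTE uF).
Qed.

Lemma corank0P T : reflect (forall u, {in T, forall F, subsum F u = 0} -> u = 0) (corank T == 0%N).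
Proof.
rewrite /corank mxrank_eq0; apply: (iffP eqP) => [k0 u /tight_mxP/sub_kermxP|h].
  by rewrite k0 submx0 => /eqP.
by apply/eqP/rowV0P => u /sub_kermxP/tight_mxP /h.
Qed.

Definition tight x : {set {set 'I_n}} := finset (fun F => subsum F x == (b F)%:R).

Lemma tightE F x : (F \in tight x) = (subsum F x == (b F)%:R).
Proof. by rewrite inE. Qed.

Local Notation P := (polyh (R := R) b).

(* The face on which the inequalities of [T] are tight is compact iff [T] covers. *)
Definition covers T := forall i : 'I_n, exists2 F, F \in T & i \in F.

Lemma covers_sub T T' : T \subset T' -> covers T -> covers T'.
Proof. by move=> /fintype.subsetP TT' cT i; have [F FT iF] := cT i; exists F => //; exact: TT'. Qed.

Lemma slack_gt0 F x : P x -> F \notin tight x -> 0 < subsum F x - (b F)%:R.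
Proof. by move=> Px; rewrite tightE => h; rewrite subr_gt0 lt_def h Px. Qed.

(** The ray is followed until it meets the first inequality that decreases along u; F0 is such an
    inequality, so the time is finite. The inequality met is not constant along u, hence the corank
    drops. *)
Lemma polyh_ray q u F0 : P q -> {in tight q, forall F, subsum F u = 0} ->
  subsum F0 u < 0 ->
  exists t, [/\ 0 < t, P (q + t *: u), tight q \subset tight (q + t *: u) &
               (corank (tight (q + t *: u)) < corank (tight q))%N].
Proof.
move=> Pq uT uF0; pose f F := (subsum F q - (b F)%:R) / - subsum F u.
case: (@arg_minP _ _ _ F0 (fun F => subsum F u < 0) f uF0) => F1 uF1 minF1.
have F1q : F1 \notin tight q by apply/negP => /uT e; rewrite e ltxx in uF1.
have nuF1 : 0 < - subsum F1 u by rewrite oppr_gt0.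
have t0 : 0 < f F1 by rewrite divr_gt0 // slack_gt0.
have E F : subsum F (q + f F1 *: u) = subsum F q + f F1 * subsum F u.
  by rewrite subsumD subsumZ.
have F1t : F1 \in tight (q + f F1 *: u).
  by rewrite tightE E; apply/eqP; rewrite /f; field; rewrite lt_eqF.
have sub : tight q \subset tight (q + f F1 *: u).
  by apply/fintype.subsetP => F Fq; move: (Fq); rewrite !tightE E uT // mulr0 addr0.
exists (f F1); split=> //; last by apply: (corank_lt sub uT F1t); rewrite lt_eqF.
move=> F; rewrite E; case: (ltP (subsum F u) 0) => uF.
  have := minF1 F uF; rewrite {2}/f ler_pdivlMr ?oppr_gt0 //.
  by rewrite mulrN; move: (f F1) => t; lra.
by rewrite -[leLHS]addr0 lerD // mulr_ge0 // ltW.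
Qed.

Lemma finite_pos_lb (I : finType) (f : I -> R) :
  (forall i, 0 < f i) -> exists2 e, 0 < e & forall i, e <= f i.
Proof.
move=> f0; exists (\big[Num.min/1]_i f i).
  by elim/big_rec: _ => // i x _ x0; rewrite lt_min f0.
by move=> i; rewrite (bigD1 i) //= ge_min lexx.
Qed.

Lemma polyh_wiggle q u : P q -> {in tight q, forall F, subsum F u = 0} ->
  exists2 e, 0 < e & forall d, `|d| <= e -> P (q + d *: u) /\ tight (q + d *: u) = tight q.
Proof.
(* Spending at most half of each positive slack keeps these inequalities strict, so no new one
   becomes tight. *)
move=> Pq uT; pose f F := if F \in tight q then 1 else
  (subsum F q - (b F)%:R) / 2 / (`|subsum F u| + 1).
have up F : 0 < `|subsum F u| + 1 by rewrite ltr_wpDl.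
have f0 F : 0 < f F.
  rewrite /f; case: (boolP (F \in tight q)) => // Fq.
  by rewrite !divr_gt0 // slack_gt0.
have [e e0 ef] := finite_pos_lb f0.
exists e => // d de.
have E F : subsum F (q + d *: u) = subsum F q + d * subsum F u.
  by rewrite subsumD subsumZ.
have S F : F \notin tight q -> (b F)%:R < subsum F (q + d *: u).
  move=> Fq; have s0 := slack_gt0 Pq Fq; have := ef F; rewrite /f (negbTE Fq).
  rewrite ler_pdivlMr // => eF.
  have : `|d * subsum F u| <= (subsum F q - (b F)%:R) / 2.
    rewrite normrM; apply: le_trans eF; apply: ler_pM => //.
    by rewrite lerDl.
  by rewrite E ler_norml => /andP[]; lra.
have S' F : F \in tight q -> subsum F (q + d *: u) = (b F)%:R.
  by move=> Fq; rewrite E uT // mulr0 addr0; apply/eqP; rewrite -tightE.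
split=> [F|]; first by case: (boolP (F \in tight q)) => [/S' ->|/S/ltW].
apply/setP => F; rewrite [LHS]tightE; case: (boolP (F \in tight q)) => [/S' ->|/S].
  exact: eqxx.
by move=> h; rewrite gt_eqF.
Qed.

(** If u were nonnegative, its zero sums over the sets of a cover would make every coordinate
    vanish. *)
Lemma neg_coord T u : covers T -> {in T, forall F, subsum F u = 0} -> u != 0 ->
  exists i, u 0 i < 0.
Proof.
move=> cT uT u0; apply: contrapT => h; move/eqP: u0; apply; apply/rowP => i; rewrite mxE.
have un j : 0 <= u 0 j by rewrite leNgt; apply/negP => uj; apply: h; exists j.
have [F FT iF] := cT i; have /eqP := uT F FT; rewrite psumr_eq0 // => /allP/(_ i).
by rewrite mem_index_enum iF => /(_ isT)/eqP.
Qed.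

(** The polyhedron lies in the orthant and so contains no line: a nonzero direction of the face has,
    up to sign, a negative coordinate, and following it leads to a face of smaller dimension. *)
Lemma vertex_below q : P q ->
  exists v, [/\ P v, corank (tight v) = 0%N & tight q \subset tight v].
Proof.
move: {2}(corank _) (leqnn (corank (tight q))) => e.
elim: e q => [|e IHe] q ce Pq; first by exists q; split=> //; move: ce; rewrite leqn0 => /eqP.
have [c0|c0] := eqVneq (corank (tight q)) 0%N; first by exists q; split.
have [u uT [i ui]] : exists2 u : 'rV[R]_n, {in tight q, forall F, subsum F u = 0} & exists i,
  u 0 i < 0.
  apply: contrapT => h; move/negP: c0; apply; apply/corank0P => u uT.
  apply/rowP => i; rewrite mxE; case: (ltgtP (u 0 i) 0) => // ui; exfalso; apply: h.
    by exists u => //; exists i.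
  exists (- u); first by move=> F FT; rewrite subsumN uT // oppr0.
  by exists i; rewrite mxE oppr_lt0.
have [|t [t0 Pq' sub cq']] := polyh_ray (F0 := finset.set1 i) Pq uT; first by rewrite subsum_set1.
have [|v [Pv cv subv]] := IHe _ _ Pq'; first by rewrite -ltnS (leq_trans cq').
by exists v; split=> //; exact: fintype.subset_trans subv.
Qed.

(** Lowering a coordinate that no tight inequality involves keeps the tight ones and ends at a new
    one, so the process stops by induction on the corank. *)
Lemma cover_below x : P x ->
  exists q, [/\ P q, covers (tight q) & forall i, q 0 i <= x 0 i].
Proof.
move: {2}(corank _) (leqnn (corank (tight x))) => e.
elim: e x => [|e IHe] x ce Px; have [|nc] := pselect (covers (tight x)).
- by exists x.
(* In corank 0 everything is covered, as the unit vector of an uncovered coordinate would be a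
   direction of the face. *)
- exfalso; apply: nc => i; apply: contrapT => h.
  have /corank0P/(_ (delta_mx 0 i)) : corank (tight x) == 0%N by rewrite -leqn0.
  suff uT : {in tight x, forall F, subsum F (delta_mx 0 i : 'rV[R]_n) = 0}.
    by move/(_ uT)/rowP/(_ i)/eqP; rewrite !mxE !eqxx oner_eq0.
  move=> F FT; rewrite /subsum big1 // => j jF; rewrite mxE eqxx /=; case: eqP => // ji; exfalso.
  by apply: h; exists F => //; rewrite -ji.
- by exists x.
have [i hi] : exists i, forall F, F \in tight x -> i \notin F.
  apply: contrapT => h; apply: nc => i; apply: contrapT => hi; apply: h; exists i => F FT.
  by apply/negP => iF; apply: hi; exists F.
pose u : 'rV[R]_n := - delta_mx 0 i.
have uT : {in tight x, forall F, subsum F u = 0}.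
  move=> F FT; rewrite subsumN /subsum big1 ?oppr0 // => j jF; rewrite mxE eqxx /=; case: eqP =>
    // ji.
  by move: (hi _ FT); rewrite -ji jF.
have [|t [t0 Px' sub cx']] := polyh_ray (F0 := finset.set1 i) Px uT.
  by rewrite subsum_set1 !mxE !eqxx oppr_lt0.
have [|q [Pq cq qx]] := IHe _ _ Px'; first by rewrite -ltnS (leq_trans cx').
exists q; split=> // j; apply: le_trans (qx j) _.
rewrite !mxE -[leRHS]addr0 lerD2l mulrN oppr_le0 mulr_ge0 //; exact: ltW.
Qed.

(* Shoot the ray from a vertex of the face through [q] until it leaves the face. *)
Lemma caratheodory q : P q -> covers (tight q) ->
  exists s : seq (R * 'rV[R]_n),
    [/\ (size s <= (corank (tight q)).+1)%N,
        forall a, a \in s -> [/\ 0 < a.1, P a.2,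
          corank (tight a.2) = 0%N & tight q \subset tight a.2],
        \sum_(a <- s) a.1 = 1 & \sum_(a <- s) a.1 *: a.2 = q].
Proof.
have [e] : exists e, (corank (tight q) <= e)%N by exists (corank (tight q)).
elim: e q => [|e IHe] q ce Pq cq; have [c0|c0] := eqVneq (corank (tight q)) 0%N.
- exists [:: (1, q)]; split=> // [x||]; rewrite ?big_seq1 ?scale1r //.
  by rewrite mem_seq1 => /eqP -> /=.
- by move: ce c0; rewrite leqn0 => ->.
- exists [:: (1, q)]; split=> // [x||]; rewrite ?big_seq1 ?scale1r //.
  by rewrite mem_seq1 => /eqP -> /=.
have [v [Pv cv subv]] := vertex_below Pq.
have vq : q - v != 0.
  by apply: contraNneq c0 => /eqP; rewrite subr_eq0 => /eqP ->; apply/eqP.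
have uT : {in tight q, forall F, subsum F (q - v) = 0}.
  move=> F Fq; have Fv := fintype.subsetP subv _ Fq; move: Fq Fv.
  by rewrite !tightE subsumB => /eqP -> /eqP ->; rewrite subrr.
have [i ui] := neg_coord cq uT vq.
have [|t [t0 Pq' sub cq']] := polyh_ray (F0 := finset.set1 i) Pq uT; first by rewrite subsum_set1.
have [||s [ss sP s1 sq]] := IHe _ _ Pq'; first by rewrite -ltnS (leq_trans cq').
  exact: covers_sub cq.
have t1 : 0 < 1 + t by rewrite addr_gt0.
(* With q' = q + t (q - v) the exit point of the ray, q = (t v + q') / (1 + t). *)
exists ((t / (1 + t), v) :: [seq ((1 + t)^-1 * a.1, a.2) | a <- s]); split.
- by rewrite /= size_map ltnS (leq_trans ss).
- move=> a; rewrite in_cons => /orP[/eqP -> /=|/mapP[y ys ->] /=].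
    by split=> //; rewrite divr_gt0.
  have [y0 Py cy suby] := sP y ys; split=> //; first by rewrite mulr_gt0 ?invr_gt0.
  exact: fintype.subset_trans suby.
- rewrite big_cons big_map /= -mulr_sumr s1 mulr1 -[X in _ + X]mul1r -mulrDl addrC.
  by rewrite divff // gt_eqF.
rewrite big_cons big_map /=.
under eq_bigr do rewrite -scalerA.
rewrite -scaler_sumr sq; apply/rowP => j; rewrite !mxE.
by field; rewrite gt_eqF.
Qed.

(** The slack at q is the weighted sum of the slacks at the points of s, all nonnegative with
    positive weights, so it vanishes only if they all do. *)
Lemma tight_barycenter (s : seq (R * 'rV[R]_n)) q :
  (forall a, a \in s -> 0 < a.1 /\ P a.2) -> \sum_(a <- s) a.1 = 1 ->
  \sum_(a <- s) a.1 *: a.2 = q ->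
  forall F, F \in tight q <-> forall a, a \in s -> F \in tight a.2.
Proof.
move=> sP s1 sq F.
have E : subsum F q - (b F)%:R = \sum_(a <- s) a.1 * (subsum F a.2 - (b F)%:R).
  have bE : (b F)%:R = \sum_(a <- s) a.1 * (b F)%:R by rewrite -mulr_suml s1 mul1r.
  rewrite -sq subsum_sum [X in _ - X]bE -sumrB.
  by apply: eq_bigr => a _; rewrite subsumZ mulrBr.
have s0 a : a \in s -> 0 <= a.1 * (subsum F a.2 - (b F)%:R).
  by move=> /sP[a0 Pa]; rewrite mulr_ge0 ?subr_ge0 // ltW.
rewrite tightE -subr_eq0 E big_seq psumr_eq0; last by move=> a; exact: s0.
split=> [/allP h a as_|h]; last first.
  apply/allP => a as_; apply/implyP => _; rewrite mulf_eq0 subr_eq0 -tightE.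
  by rewrite (h a as_) orbT.
move: (h a as_); rewrite as_ /= mulf_eq0 subr_eq0 -tightE => /orP[/eqP a0|//].
by have [] := sP a as_; rewrite a0 ltxx.
Qed.

Definition polyh_face T : set 'rV[R]_n := P `&` [set x | T \subset tight x].

(** The sum of the inequalities of T is a supporting functional: its bound is attained exactly where
    each of them is an equality. *)
Lemma polyh_face_is_face T : polyh_face T !=set0 -> is_face P (polyh_face T).
Proof.
move=> T0; split=> //.
pose a : 'rV[R]_n := \row_i \sum_(F in T) (i \in F)%:R.
have aE x : dot a x = \sum_(F in T) subsum F x.
  rewrite /dot /subsum.
  under eq_bigr do rewrite mxE mulr_suml.
  rewrite exchange_big /=; apply: eq_bigr => F _; rewrite [RHS]big_mkcond.
  by apply: eq_bigr => i _; case: ifP; rewrite ?mul1r ?mul0r.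
exists a, (\sum_(F in T) (b F)%:R); split=> [x Px|].
  by rewrite aE; apply: ler_sum => F _; exact: Px.
apply/seteqP; split=> x [Px h]; split=> //=; move: h => /=.
  move/fintype.subsetP => Tx; rewrite aE; apply: eq_bigr => F /Tx.
  by rewrite tightE => /eqP.
rewrite aE => /eqP; rewrite -subr_eq0 -sumrB psumr_eq0; last by move=> F _; rewrite subr_ge0.
move=> /allP h; apply/fintype.subsetP => F FT; rewrite tightE -subr_eq0.
by have := h F (mem_index_enum _); rewrite FT.
Qed.

Lemma dotD a x y : dot a (x + y) = dot a x + dot a y :> R.
Proof. by rewrite /dot -big_split; apply: eq_bigr => i _; rewrite mxE mulrDr. Qed.

Lemma dotZ a c x : dot a (c *: x) = c * dot a x :> R.
Proof. by rewrite /dot mulr_sumr; apply: eq_bigr => i _; rewrite mxE mulrCA. Qed.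

Lemma tight_mid x y : P x -> P y ->
  tight (2^-1 *: (x + y)) = tight x :&: tight y.
Proof.
move=> Px Py; apply/setP => F; rewrite finset.in_setI !tightE subsumZ subsumD.
have := Px F; have := Py F; move: (subsum F x) (subsum F y) (_%:R) => s t w ws wt.
apply/eqP/andP => [e|[/eqP -> /eqP ->]]; last by lra.
by split; apply/eqP; lra.
Qed.

Lemma polyh_mid x y : P x -> P y -> P (2^-1 *: (x + y)).
Proof.
move=> Px Py F; rewrite subsumZ subsumD.
by have := Px F; have := Py F; move: (subsum F x) (subsum F y) (_%:R) => s t w; lra.
Qed.

(* The witness is a point of the relative interior of the face. *)
Lemma face_polyh_face G : is_face P G ->
  exists2 q, P q & G = polyh_face (tight q).
Proof.
move=> [[q0 Gq0] [a [c [ac GE]]]].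
(* The midpoint of q and any y in G is tight only where both are, so minimality puts [tight q]
   inside [tight y]. *)
have [q Gq qmin] : exists2 q, G q & forall y, G y -> (#|tight q| <= #|tight y|)%N.
  have ex : exists e, `[< exists2 y, G y & #|tight y| = e >] by exists #|tight q0|;
    apply/asboolP; exists q0.
  case: (ex_minnP ex) => e /asboolP[y Gy <-] h; exists y => // z Gz; apply: h.
  by apply/asboolP; exists z.
have GP y : G y -> P y by rewrite GE => -[].
have Ga y : G y -> dot a y = c by rewrite GE => -[].
have Pq := GP q Gq.
exists q => //; apply/seteqP; split=> y.
  move=> Gy; split; first exact: GP.
  have Gm : G (2^-1 *: (q + y)).
    rewrite GE; split; first by apply: polyh_mid => //; exact: GP.
    by rewrite /= dotZ dotD !Ga //; field.
  have := qmin _ Gm; rewrite tight_mid //; last exact: GP.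
  move=> h; have /eqP <- : tight q :&: tight y == tight q.
    by rewrite eqEcard finset.subsetIl h.
  exact: finset.subsetIr.
move=> [Py /fintype.subsetP Tqy]; rewrite GE; split=> //=.
(* Small moves from q along both y - q and its opposite stay in the polyhedron, so the functional of
   the face, minimal at q, is constant in this direction. *)
have uT : {in tight q, forall F, subsum F (y - q) = 0}.
  by move=> F Fq; move: (Fq) (Tqy _ Fq); rewrite !tightE subsumB => /eqP -> /eqP ->; rewrite subrr.
have [e e0 h] := polyh_wiggle Pq uT.
have [P1 _] : P (q + e *: (y - q)) /\ tight (q + e *: (y - q)) = tight q.
  by apply: h; rewrite ger0_norm // ltW.
have [P2 _] : P (q + (- e) *: (y - q)) /\ tight (q + (- e) *: (y - q)) = tight q.
  by apply: h; rewrite normrN ger0_norm // ltW.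
have := ac _ P1; have := ac _ P2; rewrite !dotD !dotZ Ga // mulNr.
have -> : dot a y = c + dot a (y - q) by rewrite -{1}(Ga q Gq) -dotD addrC subrK.
move: (dot a _) => d h1 h2; have : e * d = 0 by lra.
by move/eqP; rewrite mulf_eq0 gt_eqF //= => /eqP ->; rewrite addr0.
Qed.

Lemma vertex_corank v : is_vertex P v <-> P v /\ corank (tight v) = 0%N.
Proof.
split=> [fv|[Pv cv]].
  have [q Pq e] := face_polyh_face fv.
  have vq : q = v.
    have : polyh_face (tight q) q by split=> //=.
    by rewrite -e.
  move: e Pq; rewrite vq => e Pv; split=> //; apply/eqP/corank0P => u uT.
  have [d d0 h] := polyh_wiggle Pv uT.
  have [] : P (v + d *: u) /\ tight (v + d *: u) = tight v.
    by apply: h; rewrite ger0_norm // ltW.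
  move=> Pd Td; have : polyh_face (tight v) (v + d *: u) by split=> //=; rewrite Td.
  rewrite -e /= => /eqP; rewrite -subr_eq0 addrAC subrr add0r scaler_eq0.
  by rewrite gt_eqF //= => /eqP.
rewrite /is_vertex; have -> : [set v] = polyh_face (tight v).
  apply/seteqP; split=> y; first by move=> ->; split=> //=.
  move=> [Py /fintype.subsetP Tvy] /=; apply/eqP; rewrite -subr_eq0; apply/eqP.
  move/eqP/corank0P: cv; apply => F Fv; move: (Fv) (Tvy _ Fv).
  by rewrite !tightE subsumB => /eqP -> /eqP ->; rewrite subrr.
by apply: polyh_face_is_face; exists v; split=> //=.
Qed.

End Polyhedron.

(** * Dimension and compactness of faces, rationality of vertices *)

Section Faces.
Variables (R : realType) (n : nat) (b : {set 'I_n} -> nat).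
Implicit Types (x y z q u v : 'rV[R]_n) (T : {set {set 'I_n}}).
Implicit Type F : {set 'I_n}.
Local Notation P := (polyh (R := R) b).
Local Notation face := (polyh_face (R := R) b).

Definition tight_kernel T : {vspace 'rV[R]_n} :=
  limg (linfun (mulmxr (row_base (kermx (tight_mx R T))))).

Lemma mem_tight_kernel T u : u \in tight_kernel T <-> {in T, forall F, subsum F u = 0}.
Proof.
split=> [/memv_imgP[y _ ->]|/tight_mxP/sub_kermxP].
  apply/tight_mxP/sub_kermxP; rewrite lfunE /= (submx_trans (submxMl _ _)) //.
  by rewrite eq_row_base.
rewrite -(eq_row_base (kermx _)) => /submxP[y ->].
by apply/memv_imgP; exists y; rewrite ?memvf // lfunE.
Qed.

Lemma dim_tight_kernel T : \dim (tight_kernel T) = corank R T.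
Proof.
rewrite /tight_kernel limg_dim_eq; first by rewrite dimvf /dim /= mul1n.
apply/eqP; rewrite capfv; apply/lker0P => y y'; rewrite !lfunE /=.
exact/row_free_inj/row_base_free.
Qed.

(** By [polyh_wiggle] q is in the relative interior of the face, so the differences of points of the
    face span the whole kernel of its tight inequalities. *)
Lemma affine_dim_face q d : P q -> affine_dim (face (tight b q)) d <-> d = corank R (tight b q).
Proof.
move=> Pq; have qq : face (tight b q) q by split=> //=.
have diff x y : face (tight b q) x -> face (tight b q) y ->
    y - x \in tight_kernel (tight b q).
  move=> [_ /fintype.subsetP Tx] [_ /fintype.subsetP Ty]; apply/mem_tight_kernel => F Fq.
  by move: (Tx _ Fq) (Ty _ Fq); rewrite !tightE subsumB => /eqP -> /eqP ->; rewrite subrr.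
have span x (V : {vspace 'rV[R]_n}) : face (tight b q) x ->
    (forall y, face (tight b q) y -> y - x \in V) -> (tight_kernel (tight b q) <= V)%VS.
  move=> xq hV; apply/subvP => u /mem_tight_kernel uT.
  have [e e0 h] := polyh_wiggle Pq uT.
  have [Pe Te] : P (q + e *: u) /\ tight b (q + e *: u) = tight b q.
    by apply: h; rewrite ger0_norm // ltW.
  have fe : face (tight b q) (q + e *: u) by split=> //=; rewrite Te.
  have -> : u = e^-1 *: ((q + e *: u - x) - (q - x)).
    by rewrite opprB addrA subrK addrAC subrr add0r scalerA mulVf ?scale1r // gt_eqF.
  by rewrite memvZ // memvB // hV.
split=> [[x xq [U [<- UP Umin]]]|->].
  rewrite -dim_tight_kernel; congr (\dim _); apply/eqP; rewrite eqEsubv.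
  by rewrite (span x) // andbT Umin // => y; exact: diff.
exists q => //; exists (tight_kernel (tight b q)); split; first exact: dim_tight_kernel.
  by move=> y; exact: diff.
by move=> V hV; exact: (span q).
Qed.

Lemma subsum_continuous F : continuous (subsum (R := R) F).
Proof.
rewrite /subsum; elim: (index_enum _) => [|i r IHr] x.
  under eq_fun do rewrite big_nil.
  by move=> t /nbhs_singleton t0; rewrite /nbhs /=; apply: (@filterE _ (nbhs x)) => y; exact: t0.
under eq_fun do rewrite big_cons; case: ifP => _; last exact: IHr.
exact: (@continuousD R R^o 'rV[R]_n (fun y => y 0 i) _ x (@coord_continuous R 1 n 0 i x) (IHr x)).
Qed.

Lemma closed_face T : closed (face T).
Proof.
have -> : face T =
    \bigcap_(F in setT) (subsum F @^-1` [set t | (b F)%:R <= t]) `&`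
    \bigcap_(F in [set F | F \in T]) (subsum F @^-1` [set t | t = (b F)%:R]).
  apply/seteqP; split=> x [h1 h2]; split.
  - by move=> F _; exact: h1.
  - by move=> F /(fintype.subsetP h2); rewrite tightE => /eqP.
  - by move=> F; exact: h1.
  - by apply/fintype.subsetP => F FT; rewrite tightE; apply/eqP; exact: (h2 F FT).
apply: closedI; apply: closed_bigI => F _; apply: preimage_closed.
- by move=> x _; exact: subsum_continuous.
- exact: closed_ge.
- by move=> x _; exact: subsum_continuous.
- exact: closed_eq.
Qed.

Lemma coord_le_norm x i : `|x 0 i| <= `|x|.
Proof.
have -> : `|x| = mx_norm x by [].
rewrite mx_normrE; apply/bigmax_geP; right => /=.
by exists (0, i).
Qed.

(** The ray from q along an uncovered coordinate stays in the face. A covered coordinate is bounded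
    by the value b F of a tight set F that contains it. *)
Lemma compact_face q : P q -> compact (face (tight b q)) <-> covers (tight b q).
Proof.
move=> Pq; split=> [/compact_bounded[M [_ hM]] i|cq].
  apply: contrapT => hi; pose t := `|M| + 2.
  have qt : face (tight b q) (q + t *: delta_mx 0 i).
    have E F : subsum F (q + t *: delta_mx 0 i) = subsum F q + t * (i \in F)%:R.
      rewrite subsumD subsumZ; congr (_ + _ * _); rewrite /subsum.
      case: (boolP (i \in F)) => iF.
        by rewrite (bigD1 i) //= big1 ?addr0 ?mxE ?eqxx // => j /andP[_ /negbTE ji]; rewrite mxE ji.
      by rewrite big1 // => j jF; rewrite mxE eqxx /=; case: eqP jF => // ->; rewrite (negbTE iF).
    have t0 : 0 <= t by rewrite addr_ge0.
    split=> [F|]; first by rewrite E -[leLHS]addr0 lerD // mulr_ge0.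
    apply/fintype.subsetP => F Fq; move: (Fq); rewrite !tightE E; case: (boolP (i \in F)) => iF.
      by case: hi; exists F.
    by rewrite mulr0 addr0.
  have M1 : M < `|M| + 1 by rewrite ltr_pwDr // ler_norm.
  have := le_trans (coord_le_norm _ i) (hM _ M1 _ qt).
  rewrite !mxE !eqxx mulr1 => /(le_trans (ler_norm _)).
  by have := polyh_nneg i Pq; rewrite /t; lra.
apply: bounded_closed_compact; last exact: closed_face.
exists (\sum_F b F)%:R; split=> // M hM x [Px /fintype.subsetP Tx] /=.
apply: le_trans (ltW hM).
have -> : `|x| = mx_norm x by [].
rewrite mx_normrE; apply/bigmax_leP; split=> // -[j i] _ /=.
rewrite ord1 ger0_norm; last exact: polyh_nneg Px.
have [F Fq iF] := cq i; apply: (@le_trans _ _ (b F)%:R); last first.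
  by rewrite ler_nat (bigD1 F) //= leq_addr.
move: (Tx _ Fq); rewrite tightE => /eqP <-; rewrite /subsum (bigD1 i) //= lerDl.
by apply: sumr_ge0 => k _; exact: polyh_nneg Px.
Qed.

Lemma corank_le_dim T : (corank R T <= n)%N.
Proof. exact: rank_leq_col. Qed.

Lemma mdc_polyh x0 : P x0 -> exists q0,
  [/\ P q0, covers (tight b q0), is_mdc P (corank R (tight b q0)) &
      forall q, P q -> covers (tight b q) -> (corank R (tight b q) <= corank R (tight b q0))%N].
Proof.
move=> /cover_below[q1 [Pq1 cq1 _]].
pose D e := `[< exists q, [/\ P q, covers (tight b q) & corank R (tight b q) = e] >].
have exD : exists e, D e by exists (corank R (tight b q1)); apply/asboolP; exists q1.
have ubD e : D e -> (e <= n)%N by move=> /asboolP[q [_ _ <-]]; exact: corank_le_dim.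
case: (ex_maxnP exD ubD) => m /asboolP[q0 [Pq0 cq0 <-]] hm.
have max q : P q -> covers (tight b q) -> (corank R (tight b q) <= corank R (tight b q0))%N.
  by move=> Pq cq; apply: hm; apply/asboolP; exists q.
exists q0; split=> //; split.
  exists (face (tight b q0)); split.
  - by apply: polyh_face_is_face; exists q0; split=> //=.
  - exact/compact_face.
  - exact/affine_dim_face.
move=> G d /face_polyh_face[q Pq ->] /(compact_face Pq) cq /(affine_dim_face _ Pq) ->.
exact: max.
Qed.

Lemma common_denominator (J : finType) (f : J -> rat) :
  exists2 N : nat, (0 < N)%N & exists z : J -> int, forall j, N%:R * f j = (z j)%:~R.
Proof.
exists (\prod_j `|denq (f j)|)%N; first by rewrite prodn_gt0 // => j; rewrite absz_gt0 denq_neq0.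
exists (fun j => (\prod_(i | i != j) `|denq (f i)|)%:Z * numq (f j)) => j.
rewrite (bigD1 j) //= natrM rmorphM /= [X in X * _]mulrC -mulrA; congr (_ * _).
have -> : `|denq (f j)|%:R = (denq (f j))%:~R :> rat.
  by rewrite -[RHS]/(_%:~R) -[in RHS]absz_denq.
by rewrite numqE mulrC.
Qed.

(** The tight equations determine v; their matrix is rational of full rank, so a one-sided inverse
    with rational entries recovers v from the integers b F. *)
Lemma vertex_rational v : P v -> corank R (tight b v) = 0%N ->
  exists w : 'rV[rat]_n, v = map_mx ratr w.
Proof.
move=> Pv /eqP; rewrite /corank mxrank_eq0 kermx_eq0 -tight_mx_rat row_free_map => /row_freeP[B AB].
pose beta : 'rV[rat]_#|{set 'I_n}| :=
  \row_j if enum_val j \in tight b v then (b (enum_val j))%:R else 0.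
exists (beta *m B); rewrite map_mxM.
have -> : map_mx ratr beta = v *m map_mx ratr (tight_mx rat (tight b v)).
  apply/rowP => j; rewrite !mxE; case: ifP => jT; last first.
    by rewrite rmorph0 big1 // => i _; rewrite !mxE jT rmorph0 mulr0.
  move: (jT); rewrite tightE ratr_nat => /eqP <-; rewrite /subsum big_mkcond.
  by apply: eq_bigr => i _; rewrite !mxE jT ratr_nat /=; case: ifP; rewrite ?mulr1 ?mulr0.
by rewrite -mulmxA -map_mxM AB map_mx1 mulmx1.
Qed.

(* Coordinates on the direction space of a face, with integral dual vectors. *)
Lemma kernel_coords T : exists r (f : 'I_r -> 'I_n),
  [/\ r = corank R T,
      forall u, {in T, forall F, subsum F u = 0} -> (forall j, u 0 (f j) = 0) -> u = 0 &
      exists2 N : nat, (0 < N)%N & exists l : 'I_r -> 'I_n -> int,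
        (forall j, {in T, forall F, \sum_(i in F) l j i = 0}) /\
        (forall j j', l j (f j') = if j == j' then N%:Z else 0)].
Proof.
pose A := tight_mx rat T; pose B := row_base (kermx A).
have fullB : row_full B^T by rewrite /row_full mxrank_tr; exact: row_base_free.
pose f := fullrankfun fullB; pose C := colsub f B.
have Cu : C \in unitmx.
  by rewrite /C -unitmx_tr trmx_mxsub; exact: fullrowsub_unit.
exists (\rank (kermx A)), f; split.
- by rewrite /corank -tight_mx_rat -map_kermx mxrank_map.
- move=> u uT uf; have /submxP[y uE] : (u <= map_mx ratr B)%MS.
    have /tight_mxP/sub_kermxP := uT; rewrite -tight_mx_rat -map_kermx => h.
    by apply: submx_trans h _; rewrite map_submx eq_row_base.
  have : y *m map_mx ratr C = 0.
    apply/rowP => j; rewrite [LHS]mxE [RHS]mxE -[RHS](uf j) uE [RHS]mxE; apply: eq_bigr => i _.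
    by rewrite !mxE.
  move/(congr1 (mulmx^~ (map_mx ratr (invmx C))));
    rewrite -mulmxA -map_mxM mulmxV // map_mx1 mulmx1 mul0mx.
  by move=> y0; rewrite uE y0 mul0mx.
(* The rows of D form the basis of the kernel that is dual to the coordinates chosen by f; N clears
   its denominators. *)
pose D := invmx C *m B.
have [N N0 [z zE]] := common_denominator (fun ij : 'I_(\rank (kermx A)) * 'I_n => D ij.1 ij.2).
exists N => //; exists (fun j i => z (j, i)); split=> [j F FT|j j']; apply: (@intr_inj rat).
  rewrite rmorph0 rmorph_sum /=; under eq_bigr do rewrite -zE /=.
  rewrite -mulr_sumr; apply/eqP; rewrite mulf_eq0; apply/orP; right; apply/eqP.
  have DA : D *m A = 0.
    by apply/sub_kermxP; rewrite /D (submx_trans (submxMl _ _)) // eq_row_base.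
  transitivity ((D *m A) j (enum_rank F)); last by rewrite DA mxE.
  rewrite [RHS]mxE [LHS]big_mkcond; apply: eq_bigr => i _; rewrite [A _ _]mxE enum_rankK FT /=.
  by case: ifP; rewrite ?mulr1 ?mulr0.
rewrite -zE /=; have -> : D j (f j') = (j == j')%:R.
  have : colsub f D = 1%:M by rewrite /D -mulmx_colsub mulVmx.
  by move/matrixP/(_ j j'); rewrite !mxE.
by case: ifP; rewrite ?mulr1 ?mulr0.
Qed.

Lemma denominator_ratr (a : rat) : denominator (ratr a : R) = `|denq a|%N.
Proof.
rewrite /denominator; case: pselect => [h|[]]; last by exists a.
by case: cid => a' /= /(fmorph_inj _) ->.
Qed.

Lemma denominator_dvd (d : nat) (x : R) (z : int) : (0 < d)%N -> d%:R * x = z%:~R ->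
  (denominator x %| d)%N.
Proof.
move=> d0 dx; have -> : x = ratr (z%:~R / d%:R).
  by rewrite fmorph_div /= ratr_int ratr_nat -dx mulrC mulKf // pnatr_eq0 -lt0n.
rewrite denominator_ratr; have dz : d%:Z != 0 by rewrite -lt0n.
change (`|denq (z%:Q / d%:Z%:Q)| %| `|d%:Z|)%N.
case: divqP dz => [n'|k a k0 _]; first by rewrite eqxx.
by rewrite abszM dvdn_mull.
Qed.

Lemma denominator_mul (c : nat) (a : rat) : (denominator (ratr a : R) %| c)%N ->
  exists z : int, c%:R * (ratr a : R) = z%:~R.
Proof.
rewrite denominator_ratr => /dvdnP[e ->]; exists (e%:Z * numq a).
have -> : (e * `|denq a|)%:R = e%:R * ratr (denq a)%:~R :> R.
  by rewrite natrM ratr_int; congr (_ * _); rewrite -[in RHS]absz_denq.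
by rewrite -mulrA -rmorphM /= [_ * a]mulrC -numqE ratr_int intrM.
Qed.

End Faces.

(** * Veronese degrees *)

Section Veronese.
Variables (R : realType) (n : nat) (b : {set 'I_n} -> nat).
Implicit Types (x y z q v : 'rV[R]_n) (m u : multinom n).
Implicit Type F : {set 'I_n}.
Local Notation P := (polyh (R := R) b).
Local Notation mnm_sum s := (\big[@mnm_add n/mnm0]_(m <- s) m).

Lemma degs_mnm_sum F (s : seq (multinom n)) :
  degs F (mnm_sum s) = (\sum_(m <- s) degs F m)%N.
Proof. by elim/big_rec2: _ => [|m i y _ <-]; [exact: degs0|exact: degsD]. Qed.

Lemma symb_exps_polyh e m : (0 < e)%N -> symb_exps b e m <-> P (e%:R^-1 *: mnm_row R m).
Proof.
move=> e0; have eR : 0 < e%:R :> R by rewrite ltr0n.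
split=> h F; have := h F; rewrite subsumZ subsum_mnm_row ler_pdivlMl //.
  by rewrite -natrM ler_nat.
by rewrite -natrM ler_nat.
Qed.

Lemma symb_expsD d e m m' : symb_exps b d m -> symb_exps b e m' ->
  symb_exps b (d + e) (mnm_add m m').
Proof. by move=> hm hm' F; rewrite degsD mulnDl leq_add. Qed.

Lemma symb_exps_sum d (s : seq (multinom n)) :
  {in s, forall m, symb_exps b d m} -> symb_exps b (size s * d) (mnm_sum s).
Proof.
elim: s => [|m s IHs] h; first by move=> F; rewrite mul0n.
rewrite big_cons mulSn; apply: symb_expsD; first by apply: h; rewrite mem_head.
by apply: IHs => m' m's; apply: h; rewrite in_cons m's orbT.
Qed.

(** The iteration starts from the set of all exponents; the arbitrary summand this leaves is
    absorbed into a member of U by up-closedness, for which e must be positive. *)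
Lemma sumset_powP (U : set (multinom n)) e m : sumset_pow U e m ->
  up_closed U -> (0 < e)%N ->
  exists s : seq (multinom n), [/\ size s = e, {in s, forall u, U u} & m = mnm_sum s].
Proof.
case: e => // e + upU _; elim: e m => [|e IHe] m [u [v [Uu Vv ->]]].
  exists [:: mnm_add u v]; rewrite big_seq1; split=> // w; rewrite mem_seq1 => /eqP ->.
  exact: upU.
have [s [ss sU ->]] := IHe v Vv; exists (u :: s); rewrite /= ss big_cons; split=> // w.
by rewrite in_cons => /orP[/eqP ->//|/sU].
Qed.

Definition exps_veronese d := forall e, (0 < e)%N ->
  symb_exps b (d * e) = sumset_pow (symb_exps b d) e.

(* A large multiple N d v of a vertex is a sum of N points of d P, all equal to d v. *)
Lemma vertex_denominator_dvd d v i : (0 < d)%N -> exps_veronese d -> is_vertex P v ->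
  (denominator (v 0%R i) %| d)%N.
Proof.
move=> d0 dV /vertex_corank[Pv cv]; have [w vE] := vertex_rational Pv cv.
have [N N0 [z zE]] := common_denominator (fun j : 'I_n => w 0 j).
have dR : 0 < d%:R :> R by rewrite ltr0n.
have NR : 0 < N%:R :> R by rewrite ltr0n.
have NvE j : N%:R * v 0 j = (z j)%:~R.
  by rewrite vE mxE -ratr_int -zE rmorphM /= ratr_nat.
have z0 j : 0 <= z j.
  by rewrite -(ler_int R) -NvE mulr_ge0 ?ler0n //; exact: polyh_nneg Pv.
pose m := Multinom [tuple (d * `|z j|)%N | j < n].
have mE : mnm_row R m = (d * N)%:R *: v.
  apply/rowP => j; rewrite !mxE mnmE !natrM -mulrA NvE; congr (_ * _).
  by rewrite pmulrn gez0_abs.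
have : symb_exps b (d * N) m.
  apply/symb_exps_polyh; first by rewrite muln_gt0 d0.
  by rewrite mE scalerA mulVf ?scale1r // pnatr_eq0 -lt0n muln_gt0 d0.
rewrite dV // => /sumset_powP[||s [ss sA mS]] //; first exact: symb_exps_up.
pose t : seq (R * 'rV[R]_n) := [seq (N%:R^-1, d%:R^-1 *: mnm_row R u) | u <- s].
have tP a : a \in t -> 0 < a.1 /\ P a.2.
  move=> /mapP[u us ->]; split=> /=; first by rewrite invr_gt0.
  by apply/symb_exps_polyh => //; exact: sA.
have t1 : \sum_(a <- t) a.1 = 1.
  rewrite big_map big_const_seq count_predT ss iter_addr_0 -[(_^-1) *+ _]mulr_natr mulVf //.
  by rewrite gt_eqF.
have tv : \sum_(a <- t) a.1 *: a.2 = v.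
  rewrite big_map /= -scaler_sumr -scaler_sumr.
  have -> : \sum_(u <- s) mnm_row R u = mnm_row R m.
    rewrite mS; elim: (s) => [|u s' IHs].
      by rewrite !big_nil; apply/rowP => j; rewrite !mxE mnm0E.
    by rewrite !big_cons IHs; apply/rowP => j; rewrite !mxE mnmDE natrD.
  rewrite mE !scalerA natrM; apply/rowP => j; rewrite !mxE.
  by field; rewrite !gt_eqF.
have [u us] : exists u, u \in s by case: (s) ss N0 => [<-//|u s' _ _]; exists u; rewrite mem_head.
have ut : (N%:R^-1, d%:R^-1 *: mnm_row R u) \in t by exact: map_f.
(* Whatever is tight at the mean v is tight at each summand, and these equations have only one
   solution since v is a vertex. *)
have uv : d%:R^-1 *: mnm_row R u - v = 0.
  move/eqP/corank0P: cv; apply => F Fv.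
  have /= := (tight_barycenter tP t1 tv F).1 Fv _ ut.
  by move: Fv; rewrite !tightE subsumB => /eqP -> /eqP ->; rewrite subrr.
apply: (@denominator_dvd R d _ (u i)%:Z) => //.
have -> : v = d%:R^-1 *: mnm_row R u by apply/eqP; rewrite eq_sym -subr_eq0 uv.
by rewrite !mxE mulrA mulfV ?mul1r // gt_eqF.
Qed.

Lemma lcm_denominators_dvd (vs : seq 'rV[R]_n) d :
  (forall v i, v \in vs -> (denominator (v 0%R i) %| d)%N) <-> (lcm_denominators vs %| d)%N.
Proof.
rewrite /lcm_denominators; elim: vs => [|v vs IHvs].
  by rewrite big_nil; split=> // _; exact: dvd1n.
rewrite big_cons dvdn_lcm; split=> [h|/andP[/dvdn_biglcmP hv /IHvs hvs] w i].
  apply/andP; split; first by apply/dvdn_biglcmP => i _; apply: h; rewrite mem_head.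
  by apply/IHvs => w i wvs; apply: h; rewrite in_cons wvs orbT.
by rewrite in_cons => /orP[/eqP ->|/hvs]; [exact: hv|exact].
Qed.

(** The list s is cut into e blocks of length a. The lower bound on its size leaves only the last
    block possibly incomplete, and m' makes up for what is missing there. *)
Lemma sumset_pow_group a c e (s : seq (multinom n)) m' : (0 < e)%N ->
  {in s, forall m, symb_exps b c m} ->
  (e.-1 * a <= size s <= e * a)%N -> symb_exps b ((e * a - size s) * c) m' ->
  sumset_pow (symb_exps b (a * c)) e (mnm_add (mnm_sum s) m').
Proof.
case: e => // e _; elim: e s => [|e IHe] s sA /=.
  rewrite mul1n => /= sa m'A; exists (mnm_add (mnm_sum s) m'), mnm0; rewrite addm0; split=> //.
  have := symb_expsD (symb_exps_sum sA) m'A.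
  by rewrite -mulnDl subnKC //; move: sa; lia.
move=> sa m'A; exists (mnm_sum (take a s)), (mnm_add (mnm_sum (drop a s)) m'); split.
- have sz : size (take a s) = a by rewrite size_takel //; move: sa; nia.
  by rewrite -{1}sz; apply: symb_exps_sum => m /mem_take /sA.
- apply: IHe; first by move=> m /mem_drop /sA.
    by rewrite size_drop; move: sa; nia.
  by move: m'A; rewrite size_drop; congr (symb_exps b (_ * c) _); move: sa; nia.
by rewrite addmA -big_cat cat_take_drop.
Qed.

Definition floor_mnm x : multinom n := Multinom [tuple Num.truncn (x 0 i) | i < n].

Lemma floor_mnmK c v : P v -> (exists z : 'I_n -> int, forall i, c%:R * v 0 i = (z i)%:~R) ->
  mnm_row R (floor_mnm (c%:R *: v)) = c%:R *: v.
Proof.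
move=> Pv [z zE]; apply/rowP => i; rewrite !mxE mnmE !mxE zE.
have z0 : 0 <= z i by rewrite -(ler_int R) -zE mulr_ge0 ?ler0n //; exact: polyh_nneg Pv.
by rewrite -(gez0_abs z0) -pmulrn natrK.
Qed.

Lemma exps_veronese_mul a c : (0 < a)%N -> (0 < c)%N ->
  (forall q, P q -> covers (tight b q) -> (corank R (tight b q) <= a)%N) ->
  (forall v, P v -> corank R (tight b v) = 0%N ->
     exists z : 'I_n -> int, forall i, c%:R * v 0 i = (z i)%:~R) ->
  exps_veronese (a * c).
Proof.
move=> a0 c0 ca cv e e0; apply/seteqP; split=> m; last exact: sumset_pow_sub.
have cR : 0 < c%:R :> R by rewrite ltr0n.
have ace : (0 < a * c * e)%N by rewrite !muln_gt0 a0 c0.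
have KR : 0 < (a * c * e)%:R :> R by rewrite ltr0n.
move/(symb_exps_polyh _ ace); set x := _ *: _ => Px.
have [q [Pq cq qx]] := cover_below Px.
have [s [ss sP s1 sq]] := caratheodory Pq cq.
have {}ss : (size s <= a.+1)%N by rewrite (leq_trans ss) // ltnS ca.
pose V (p : R * 'rV[R]_n) := floor_mnm (c%:R *: p.2).
have VE p : p \in s -> mnm_row R (V p) = c%:R *: p.2.
  by move=> /sP[_ Pp cp _]; apply: floor_mnmK => //; exact: cv.
(* These are the coefficients of (a c e) q in terms of the lattice points c p.2; f rounds them
   down. *)
pose t (p : R * 'rV[R]_n) := (a * e)%:R * p.1.
have t0 p : p \in s -> 0 <= t p by move=> /sP[p0 _ _ _]; rewrite mulr_ge0 // ltW.
pose f p := Num.truncn (t p).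
have ft p : p \in s -> (f p)%:R <= t p < (f p).+1%:R.
  by move=> ps; apply: truncn_itv; exact: t0.
pose S := (\sum_(p <- s) f p)%N.
have tE : \sum_(p <- s) t p = (a * e)%:R by rewrite -mulr_sumr s1 mulr1.
have Sle : (S <= a * e)%N.
  rewrite -(ler_nat R) -tE natr_sum big_seq [leRHS]big_seq; apply: ler_sum => p.
  by move=> /ft/andP[].
(* Rounding loses less than 1 at each of at most a + 1 vertices, so an integral loss is at most a
   and at least (e - 1) a lattice points remain. *)
have Sgt : (a * e < S + a.+1)%N.
  apply: (@leq_trans (S + size s)); last by rewrite leq_add2l.
  rewrite -(ltr_nat R) natrD -tE natr_sum.
  have -> : (size s)%:R = \sum_(p <- s) 1 :> R by rewrite big_const_seq count_predT iter_addr_0.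
  rewrite -big_split big_seq [ltRHS]big_seq; apply: ltr_sum => [|p ps]; last first.
    by have /andP[_] := ft p ps; rewrite -natr1.
  apply/hasP; case: (s) s1 => [|p s' _]; last by exists p; rewrite /= mem_head.
  by rewrite big_nil => /eqP; rewrite eq_sym oner_eq0.
have VA p : p \in s -> symb_exps b c (V p).
  by move=> ps; apply/symb_exps_polyh => //; rewrite VE // scalerA mulVf ?scale1r ?gt_eqF //;
    have [] := sP p ps.
pose L := flatten [seq nseq (f p) (V p) | p <- s].
have sL : size L = S.
  rewrite size_flatten /shape -map_comp sumnE big_map.
  by apply: eq_bigr => p _; rewrite /= size_nseq.
have LA : {in L, forall u, symb_exps b c u}.
  move=> u /flattenP[l /mapP[p ps ->]]; rewrite mem_nseq => /andP[_ /eqP ->].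
  exact: VA.
have dL F : degs F (mnm_sum L) = (\sum_(p <- s) f p * degs F (V p))%N.
  rewrite degs_mnm_sum big_flatten big_map; apply: eq_bigr => p _.
  by rewrite big_nseq iter_addn_0 mulnC.
(* What is left of m dominates the combination of the c p.2 with the fractional parts as
   coefficients. These add up to a e - S, and each c p.2 has F-sum at least c b F. *)
have key F : (degs F (mnm_sum L) + (a * e - S) * (c * b F) <= degs F m)%N.
  have dm : (degs F m)%:R = (a * c * e)%:R * subsum F x.
    by rewrite /x subsumZ subsum_mnm_row mulrA mulfV ?mul1r // gt_eqF.
  have xq : subsum F q <= subsum F x by apply: ler_sum => i _; exact: qx.
  rewrite -(ler_nat R) dm dL; apply: le_trans (ler_wpM2l (ltW KR) xq).
  rewrite -sq subsum_sum mulr_sumr natrD natrM natrB // -tE !natr_sum.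
  rewrite -sumrB mulr_suml -big_split big_seq [leRHS]big_seq; apply: ler_sum => p ps /=.
  have -> : (a * c * e)%:R * subsum F (p.1 *: p.2) = t p * (degs F (V p))%:R.
    by rewrite -(subsum_mnm_row R) VE // !subsumZ /t !natrM; ring.
  have fp : (f p)%:R <= t p by have /andP[] := ft p ps.
  have dV : (c * b F)%:R <= (degs F (V p))%:R :> R by rewrite ler_nat VA.
  rewrite natrM -lerBrDl -mulrBl; apply: ler_wpM2l => //; by rewrite subr_ge0.
have Lm : lem (mnm_sum L) m.
  apply/mnm_lepP => i; have := key (finset.set1 i).
  by rewrite /degs !big_set1; apply: leq_trans; exact: leq_addr.
rewrite -(submK Lm) addmC; apply: sumset_pow_group => //.
  rewrite sL [(e * a)%N]mulnC Sle andbT.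
  have aE : (a * e = a + e.-1 * a)%N by rewrite -{1}(prednK e0) mulnS [(a * _)%N]mulnC.
  by move: Sgt; rewrite aE; lia.
move=> F; have := key F; rewrite -[in degs F m](submK Lm) degsD sL [(e * a)%N]mulnC.
by rewrite mulnA; lia.
Qed.

End Veronese.

(** * Krull dimension of the symbolic fiber *)

Section KrullDimension.

Lemma prime_chain_preimage (A B : comNzRingType) (p : {rmorphism A -> B}) d
    (Q : 'I_d.+1 -> set B) : (forall y, exists x, p x = y) ->
  prime_chain Q -> prime_chain (fun i => p @^-1` Q i).
Proof.
move=> surj [prQ incQ]; split=> [i|i j ij].
  have [[Q0 QD QM] Q1 QP] := prQ i; split=> [|/=|x y /=].
  - split=> [|x y /= Qx Qy|a x /= Qx]; first by rewrite /= rmorph0.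
      by rewrite rmorphD; exact: QD.
    by rewrite rmorphM; exact: QM.
  - by rewrite rmorph1.
  - by rewrite rmorphM => /QP.
have [sub nsub] := incQ i j ij; split=> [x /=|h]; first exact: sub.
by apply: nsub => y; have [x <-] := surj y; exact: h.
Qed.

Lemma prime_chain_image (A B : comNzRingType) (p : {rmorphism A -> B}) d
    (P : 'I_d.+1 -> set A) : (forall y, exists x, p x = y) ->
  (forall i x, p x = 0 -> P i x) ->
  prime_chain P -> prime_chain (fun i => p @` P i).
Proof.
move=> surj kerP [prP incP].
have memP i x : (p @` P i) (p x) <-> P i x.
  split=> [[y Py e]|]; last by exists x.
  have [[_ PD _] _ _] := prP i; rewrite -(subrK y x); apply: PD => //.
  by apply: kerP; rewrite rmorphB e subrr.
split=> [i|i j ij].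
  have [[P0 PD PM] P1 PP] := prP i; split=> [|h|x y].
  - split=> [|_ _ [x Px <-] [y Py <-]|a _ [x Px <-]].
    + by rewrite -(rmorph0 p); apply/memP.
    + by rewrite -rmorphD; apply/memP/PD.
    + by have [a' <-] := surj a; rewrite -rmorphM; apply/memP/PM.
  - by apply: P1; apply/memP; rewrite rmorph1.
  - have [x' <-] := surj x; have [y' <-] := surj y; rewrite -rmorphM.
    by move/memP/PP => [] h; [left|right]; apply/memP.
have [sub nsub] := incP i j ij; split=> [_ [x Px <-]|h]; first exact/memP/sub.
by apply: nsub => x /memP/h/memP.
Qed.

(** By the correspondence of primes, the dimension of the fiber can be computed with primes of the
    symbolic Rees algebra. *)
Lemma krull_dim_surj (A B : comNzRingType) (p : {rmorphism A -> B}) d :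
  (forall y, exists x, p x = y) ->
  (exists2 P : 'I_d.+1 -> set A, prime_chain P & forall i x, p x = 0 -> P i x) ->
  (forall e (P : 'I_e.+1 -> set A), prime_chain P ->
     (forall i x, p x = 0 -> P i x) -> (e <= d)%N) ->
  krull_dim B d.
Proof.
move=> surj [P chP kerP] bound; split.
  by exists (fun i => p @` P i); exact: prime_chain_image.
move=> e Q chQ; apply: (bound _ (fun i => p @^-1` Q i)).
  exact: prime_chain_preimage.
by move=> i x /= ->; have [+ _] := chQ => /(_ i)[[]].
Qed.

(** Modulo P1 only the constant coefficient survives, so it is 0; the remaining sum is divisible by
    q, which cancels modulo P0, and induction applies. *)
Lemma horner_indep (A : comNzRingType) (P0 P1 : set A) q N (E : 'I_N -> A) :
  prime_ideal P0 -> is_ideal P1 -> P0 `<=` P1 -> P1 q -> ~ P0 q ->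
  (forall i, P1 (E i) -> E i = 0) -> P0 (\sum_(i < N) E i * q ^+ i) ->
  forall i, E i = 0.
Proof.
move=> prP0 [_ P1D P1M] P01 P1q P0q; elim: N E => [|N IHN] E E0 P0E; first by case.
have SE : \sum_(i < N.+1) E i * q ^+ i =
    E ord0 + q * \sum_(i < N) E (lift ord0 i) * q ^+ i.
  rewrite big_ord_recl expr0 mulr1 mulr_sumr; congr (_ + _); apply: eq_bigr => i _.
  by rewrite exprS mulrCA.
rewrite SE in P0E.
have E00 : E ord0 = 0.
  apply: E0; set w := \sum_(i < N) _ in P0E.
  have -> : E ord0 = (E ord0 + q * w) + (- w) * q by ring.
  by apply: P1D; [exact: P01|exact: P1M].
have P0w : P0 (\sum_(i < N) E (lift ord0 i) * q ^+ i).
  by move: P0E; rewrite E00 add0r; have [_ _ PM] := prP0; case/PM.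
have h := IHN (fun i => E (lift ord0 i)) (fun i => E0 _) P0w.
move=> i; case: (unliftP ord0 i) => [j ->|-> //]; exact: h.
Qed.

Definition indep_mod (k : fieldType) (A : comNzRingType) (phi : k -> A) (P : set A)
    (X : finType) (z : X -> A) :=
  forall c : X -> k, P (\sum_x phi (c x) * z x) -> forall x, c x = 0.

(* An element of [P_(i+1)] outside [P_i] is algebraically independent, modulo [P_i], of
   elements that are independent modulo [P_(i+1)]. *)
Lemma prime_chain_indep (k : fieldType) (A : comNzRingType) (phi : {rmorphism k -> A})
    (bnd : A -> nat -> Prop) :
  bnd 1 0%N -> (forall x, exists a, bnd x a) ->
  (forall x y a c, bnd x a -> bnd y c -> bnd (x * y) (a + c)%N) ->
  (forall x a c, (a <= c)%N -> bnd x a -> bnd x c) ->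
  forall e (P : 'I_e.+1 -> set A), prime_chain P ->
  exists D, forall N, exists (X : finType) (z : X -> A),
    [/\ #|X| = (N ^ e)%N, indep_mod phi (P ord0) z & forall x, bnd (z x) (N * D)%N].
Proof.
move=> bnd1 bndex bndM bndW; elim=> [|e IHe] P [prP incP].
  exists 0%N => N; exists unit, (fun _ => 1); split=> [||_]; rewrite ?card_unit ?muln0 //.
  move=> c; rewrite (bigD1 tt) //= big1 => [|[] //]; rewrite addr0 mulr1 => Pc [].
  apply/eqP; apply: contrapT => /negP c0; have [[_ _ PM] P1 _] := prP ord0.
  by apply: P1; rewrite -(rmorph1 phi) -(mulVf c0) rmorphM; exact: PM.
pose P' i := P (lift ord0 i).
have [|D hD] := IHe P'.
  split=> [i|i j ij]; first exact: prP.
  by apply: incP; rewrite !lift0 ltnS.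
have [sub /existsNP[q /not_implyP[P1q P0q]]] := incP ord0 (lift ord0 ord0) isT.
have [a qa] := bndex q.
have qX i : bnd (q ^+ i) (i * a)%N.
  by elim: i => [|i IHi]; rewrite ?expr0 // exprS mulSn; exact: bndM.
exists (a + D)%N => N; have [X [z [cX iX bX]]] := hD N.
exists ('I_N * X)%type, (fun ix : 'I_N * X => q ^+ ix.1 * z ix.2); split.
- by rewrite card_prod card_ord cX expnS.
- move=> c; pose E (i : 'I_N) := \sum_x phi (c (i, x)) * z x.
  have -> : \sum_ix phi (c ix) * (q ^+ ix.1 * z ix.2) = \sum_(i < N) E i * q ^+ i.
    transitivity (\sum_(i < N) \sum_x phi (c (i, x)) * (q ^+ i * z x)).
      by rewrite pair_bigA; apply: eq_bigr => -[].
    by apply: eq_bigr => i _; rewrite mulr_suml; apply: eq_bigr => x _; ring.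
  have E0 i : P' ord0 (E i) -> E i = 0.
    by move/iX => c0; rewrite /E big1 // => x _; rewrite c0 rmorph0 mul0r.
  have [idP1 _ _] := prP (lift ord0 ord0).
  move/(horner_indep (prP ord0) idP1 sub P1q P0q E0) => Ei [i x].
  have : P' ord0 (E i) by rewrite Ei; case: idP1.
  by move/iX/(_ x).
move=> [i x] /=; apply: (bndW _ (i * a + N * D)%N); last exact: bndM.
by rewrite mulnDr leq_add2r leq_mul2r ltnW ?orbT.
Qed.

(** If s < e, the bound (N D + 1)^s <= N^s (D + 1)^s contradicts the hypothesis as soon as N exceeds
    (D + 1)^s. *)
Lemma poly_growth_le (D e s : nat) :
  (forall N, (N ^ e <= (N * D).+1 ^ s)%N) -> (e <= s)%N.
Proof.
move=> h; rewrite leqNgt; apply/negP => es.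
pose N := (D.+1 ^ s).+1.
have N0 : (0 < N)%N by [].
have h1 : (N ^ s.+1 <= N ^ e)%N by rewrite leq_exp2l // /N ltnS expn_gt0.
have h2 : ((N * D).+1 ^ s <= N ^ s * D.+1 ^ s)%N.
  by rewrite -expnMn; case: s {h h1 N0 es} @N => // s N;
    rewrite leq_exp2r // mulnS addnC -addn1 leq_add2l.
have : (N ^ s * N <= N ^ s * D.+1 ^ s)%N.
  by rewrite -expnSr (leq_trans h1) // (leq_trans (h N)).
by rewrite leq_pmul2l ?expn_gt0 // ltnn.
Qed.

End KrullDimension.

(** * Scalars and degree bounds in the symbolic Rees algebra *)

Section ReesScalars.
Variables (k : fieldType) (n : nat) (I : set (mpoly n k)).

Lemma rees_const_proof (f : mpoly n k) : f%:P \in symb_rees_pred I.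
Proof.
apply/asboolP => j; rewrite coefC; case: eqP => [->|_]; first exact: symb_pow0.
by have [] := symb_pow_ideal I j.
Qed.

Definition rees_const f : symb_rees I := SymbRees (rees_const_proof f).

Lemma rees_const_zmod_morphism : zmod_morphism rees_const.
Proof. by move=> f g; apply: val_inj; rewrite /= polyCB. Qed.

Lemma rees_const_monoid_morphism : monoid_morphism rees_const.
Proof. by split=> [|f g]; apply: val_inj; rewrite /= ?polyCM. Qed.

HB.instance Definition _ := GRing.isZmodMorphism.Build _ _ rees_const rees_const_zmod_morphism.
HB.instance Definition _ := GRing.isMonoidMorphism.Build _ _ rees_const rees_const_monoid_morphism.

Definition rees_scalar : k -> symb_rees I := rees_const \o @mpolyC n k.
HB.instance Definition _ := GRing.RMorphism.on rees_scalar.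

Definition rees_coef (r : symb_rees I) (m : multinom n) (j : nat) : k :=
  mcoeff m (val r)`_j.

Definition rees_bound (r : symb_rees I) (a : nat) :=
  forall j m, rees_coef r m j != 0 -> (mdeg m <= a)%N /\ (j <= a)%N.

Lemma rees_bound1 : rees_bound 1 0.
Proof.
move=> j m; rewrite /rees_coef /= coef1; case: (j =P 0%N) => [->|_]; last by rewrite mcoeff0 eqxx.
by rewrite mcoeff1; case: (m =P _) => [->|_]; rewrite ?mdeg0 // eqxx.
Qed.

Lemma rees_boundW r a c : (a <= c)%N -> rees_bound r a -> rees_bound r c.
Proof. by move=> ac h j m /h[ma ja]; rewrite (leq_trans ma) // (leq_trans ja). Qed.

Lemma rees_boundM r s a c : rees_bound r a -> rees_bound s c -> rees_bound (r * s) (a + c).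
Proof.
move=> ra sc j m; rewrite /rees_coef.
have -> : val (r * s) = val r * val s by [].
rewrite coefM raddf_sum /= => nz.
have [i nzi] : exists i : 'I_j.+1, mcoeff m ((val r)`_i * (val s)`_(j - i)) != 0.
  apply: contrapT => h; move/eqP: nz; apply; apply: big1 => i _.
  by apply/eqP; apply: contrapT => /negP nzi; apply: h; exists i.
move: nzi; rewrite -mcoeff_msupp => /msuppM_le/allpairsP[[m1 m2] /= [h1 h2 ->]].
have [d1 l1] : (mdeg m1 <= a)%N /\ (i <= a)%N by apply: ra; rewrite /rees_coef -mcoeff_msupp.
have [d2 l2] : (mdeg m2 <= c)%N /\ (j - i <= c)%N by apply: sc; rewrite /rees_coef -mcoeff_msupp.
by rewrite mdegD leq_add //; split=> //; have := ltn_ord i; lia.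
Qed.

Lemma rees_bound_ex r : exists a, rees_bound r a.
Proof.
exists (\sum_(j < size (val r)) (j + \sum_(m <- msupp (val r)`_j) mdeg m))%N.
move=> j m; rewrite /rees_coef; have [js|js] := ltnP j (size (val r)); last first.
  by rewrite nth_default // mcoeff0 eqxx.
rewrite -mcoeff_msupp => mr; rewrite (bigD1 (Ordinal js)) //= (bigD1_seq m) ?msupp_uniq //=.
by split; lia.
Qed.

End ReesScalars.

(** * Upper bound for chains of primes of the fiber *)

Section SymbolicFiber.
Variables (k : fieldType) (n : nat) (b : {set 'I_n} -> nat).
Hypothesis hb : antichain_bounds b.
Implicit Types (m : multinom n) (F : {set 'I_n}).
Let I : set (mpoly n k) := mono_span (symb_exps b 1).
Local Notation rees := (symb_rees I).
Local Notation fib := (@fiber_ideal k n I).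

Lemma rees_coefP (r : rees) m j : rees_coef r m j != 0 -> symb_exps b j m.
Proof.
have /asboolP/(_ j) := symb_rees_valP r; rewrite symb_pow_symb_exps // => h.
by rewrite /rees_coef -mcoeff_msupp => /h.
Qed.

(** The monomial x^m t^j, replaced by 0 when x^m is not in I^(j). *)
Definition rees_mon : multinom n -> nat -> rees :=
  locked (fun m j => insubd (0 : rees) ((mpolyX k m)%:P * 'X^j)).

Lemma rees_monE m j : symb_exps b j m -> val (rees_mon m j) = (mpolyX k m)%:P * 'X^j.
Proof.
move=> hm; rewrite /rees_mon -lock insubdK //; apply/asboolP => i.
rewrite coefCM coefXn symb_pow_symb_exps //; case: eqP => [->|_].
  by rewrite mulr1; exact/mono_spanX.
by rewrite mulr0 => m'; rewrite msupp0.
Qed.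

Lemma rees_monM m j m' j' : symb_exps b j m -> symb_exps b j' m' ->
  rees_mon (mnm_add m m') (j + j') = rees_mon m j * rees_mon m' j'.
Proof.
move=> hm hm'; apply: val_inj; have -> : val (rees_mon m j * rees_mon m' j') =
  val (rees_mon m j) * val (rees_mon m' j') by [].
rewrite !rees_monE //; last exact: symb_expsD.
by rewrite mpolyXD polyCM exprD; ring.
Qed.

Lemma rees_expand (r : rees) :
  r = \sum_(j < size (val r)) \sum_(m <- msupp (val r)`_j)
        rees_scalar I (rees_coef r m j) * rees_mon m j.
Proof.
apply: val_inj; rewrite rmorph_sum -[LHS]coefK poly_def; apply: eq_bigr => j _.
rewrite rmorph_sum [in LHS](mpolyE (val r)`_j) scaler_suml.
apply: eq_big_seq => m mr.
transitivity ((mpolyC n (rees_coef r m j))%:P * val (rees_mon m j)); last by [].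
rewrite rees_monE; first by rewrite mulrA -polyCM mul_mpolyC mul_polyC.
by apply: rees_coefP; rewrite /rees_coef -mcoeff_msupp; exact: mr.
Qed.

Lemma rees_in_ideal (J : set rees) r : is_ideal J ->
  (forall m j, rees_coef r m j != 0 -> J (rees_mon m j)) -> J r.
Proof.
move=> idJ h; rewrite (rees_expand r); apply: ideal_sum => // j _.
apply: ideal_sum => // m mr; have [_ _] := idJ; apply; apply: h.
by rewrite /rees_coef -mcoeff_msupp.
Qed.

Lemma fiber_ideal_mon m j i : symb_exps b j m ->
  fib (rees_mon (mnm_add (mnm1 i) m) j).
Proof.
move=> hm; rewrite -[j]add0n rees_monM //.
rewrite mulrC; have [_ _] := ideal_gen_ideal [set r : rees | exists2 f,
  @irrelevant_ideal k n f & val r = f%:P].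
apply; apply: sub_gen_smallest; exists (mpolyX k (mnm1 i)).
  by apply: sub_gen_smallest; exists i.
by rewrite rees_monE // expr0 mulr1.
Qed.

(** For j > 0 these are the tight inequalities at the point m / j; the integral form also makes
    sense for j = 0. *)
Definition tset m (j : nat) : {set {set 'I_n}} := finset (fun F => degs F m == (j * b F)%N).

Lemma tset_polyh (R : realType) m j : (0 < j)%N -> tset m j = tight (R :=
  R) b (j%:R^-1 *: mnm_row R m).
Proof.
move=> j0; have jR : 0 < j%:R :> R by rewrite ltr0n.
apply/setP => F; rewrite tightE inE subsumZ subsum_mnm_row -(eqr_nat R) natrM.
by apply/eqP/eqP => [->|<-]; [rewrite mulKf // gt_eqF|rewrite mulVKf // gt_eqF].
Qed.

Lemma tsetD m j m' j' : symb_exps b j m -> symb_exps b j' m' ->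
  tset (mnm_add m m') (j + j') = tset m j :&: tset m' j'.
Proof.
move=> hm hm'; apply/setP => F; rewrite finset.in_setI !inE degsD mulnDl.
by have := hm F; have := hm' F; move: (degs F m) (degs F m') (j * _)%N (j' * _)%N; lia.
Qed.

Section PrimeSupport.
Variables (R : realType) (P : set rees).
Hypothesis prP : prime_ideal P.
Hypothesis fibP : fib `<=` P.

Definition out_exps m j := symb_exps b j m /\ ~ P (rees_mon m j).

Lemma out_exps0 m : out_exps m 0 -> m = mnm0.
Proof.
move=> [_ Pm]; apply: contrapT => m0; apply: Pm.
have [i mi] : exists i, (0 < m i)%N.
  apply: contrapT => h; apply: m0; apply/mnmP => i; rewrite mnm0E.
  by apply/eqP; rewrite -leqn0 leqNgt; apply/negP => mi; apply: h; exists i.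
have -> : m = mnm_add (mnm1 i) (mnm_sub m (mnm1 i)).
  by rewrite addmC submK // lep1mP -lt0n.
by apply: fibP; apply: fiber_ideal_mon => F; rewrite mul0n.
Qed.

Lemma out_expsD m j m' j' : out_exps m j -> out_exps m' j' -> out_exps (mnm_add m m') (j + j').
Proof.
move=> [hm Pm] [hm' Pm']; split; first exact: symb_expsD.
by rewrite rees_monM //; have [_ _ PP] := prP => /PP[].
Qed.

(** Monomials outside a prime are closed under products, and the tight set of a product is the
    intersection of the tight sets. Hence a smallest tight set in positive degree in t is contained
    in all others. If 1 is the only monomial outside P, then q0 will do. *)
Lemma out_exps_face q0 : polyh b q0 -> covers (tight (R := R) b q0) ->
  exists q, [/\ polyh b q, covers (tight (R := R) b q) &
    forall m j, out_exps m j -> tight b q \subset tset m j].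
Proof.
move=> Pq0 cq0; case: (pselect (exists m j, (0 < j)%N /\ out_exps m j)) => [ex|nex]; last first.
  exists q0; split=> // m [|j] om; last by case: nex; exists m, j.+1.
  by apply/fintype.subsetP => F _; rewrite inE (out_exps0 om) degs0.
have exD : exists e, `[< exists m j, [/\ (0 < j)%N, out_exps m j & #|tset m j| = e] >].
  by have [m [j [j0 om]]] := ex; exists #|tset m j|; apply/asboolP; exists m, j.
case: (ex_minnP exD) => e /asboolP[m [j [j0 om <-]]] emin.
have sub m' j' : out_exps m' j' -> tset m j \subset tset m' j'.
  move=> om'; have odd := out_expsD om om'.
  have h : (#|tset m j| <= #|tset (mnm_add m m') (j + j')|)%N.
    by apply: emin; apply/asboolP; exists (mnm_add m m'), (j + j')%N; rewrite addn_gt0 j0.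
  rewrite tsetD in h; [|by case: om|by case: om'].
  have /eqP <- : tset m j :&: tset m' j' == tset m j by rewrite eqEcard finset.subsetIl h.
  exact: finset.subsetIr.
have [hm Pm] := om.
exists (j%:R^-1 *: mnm_row R m); split; first exact/symb_exps_polyh.
  move=> i; rewrite -tset_polyh //; apply: contrapT => hi; apply: Pm.
  (* If no tight set contains i, every bound involving x_i has slack at least 1; so m stays in I^(j)
     after division by x_i, which puts the monomial into the fiber ideal. *)
  have gap F : i \in F -> (j * b F < degs F m)%N.
    move=> iF; rewrite ltn_neqAle hm andbT; apply/negP => /eqP e'; apply: hi.
    by exists F => //; rewrite inE e'.
  have mi : (0 < m i)%N.
    by have := gap (finset.set1 i) (set11 i); rewrite /degs big_set1; apply: leq_trans.
  have mE : m = mnm_add (mnm1 i) (mnm_sub m (mnm1 i)).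
    by rewrite addmC submK // lep1mP -lt0n.
  rewrite mE; apply: fibP; apply: fiber_ideal_mon => F; have := hm F; have := gap F.
  have -> : degs F m = ((i \in F) + degs F (mnm_sub m (mnm1 i)))%N by rewrite {1}mE degsD degs1.
  by case: (i \in F) => // /(_ isT).
by rewrite -tset_polyh.
Qed.

End PrimeSupport.

Lemma fiber_chain_le (R : realType) (c : nat) q0 :
  polyh b q0 -> covers (tight (R := R) b q0) ->
  (forall q, polyh b q -> covers (tight (R := R) b q) -> (corank R (tight b q) <= c)%N) ->
  forall e (P : 'I_e.+1 -> set rees), prime_chain P ->
    (forall i, fib `<=` P i) -> (e <= c.+1)%N.
Proof.
move=> Pq0 cq0 hc e P chP fibP; have prP0 := chP.1 ord0.
have [q [Pq cq Tq]] := out_exps_face prP0 (fibP ord0) Pq0 cq0.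
have [r [f [rE finj _]]] := kernel_coords R (tight b q).
have rc : (r <= c)%N by rewrite rE hc.
(* For fixed j, differences of exponents outside the prime are directions of the face, hence are
   determined by r coordinates. This leaves at most B^(r+1) monomials outside the prime in the box
   of size B. *)
have out_inj m m' j : out_exps (P ord0) m j -> out_exps (P ord0) m' j ->
    (forall i, m (f i) = m' (f i)) -> m = m'.
  move=> /Tq/fintype.subsetP om /Tq/fintype.subsetP om' mm'.
  have : mnm_row R m - mnm_row R m' = 0.
    apply: finj => [F Fq|i]; last by rewrite !mxE mm' subrr.
    move: (om _ Fq) (om' _ Fq); rewrite !inE subsumB !subsum_mnm_row => /eqP -> /eqP ->.
    by rewrite subrr.
  move/eqP; rewrite subr_eq0 => /eqP/rowP mE; apply/mnmP => i.
  by have /eqP := mE i; rewrite !mxE eqr_nat => /eqP.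
have [D hD] := prime_chain_indep (rees_scalar I) (@rees_bound1 k n I)
  (@rees_bound_ex k n I) (@rees_boundM k n I) (@rees_boundW k n I) chP.
apply: (@poly_growth_le D) => N; have [X [z [<- iz bz]]] := hD N.
set B := (N * D).+1.
pose mnm_of (g : {ffun 'I_n -> 'I_B}) := Multinom [tuple (g i : nat) | i < n].
pose G := finset (fun gj : {ffun 'I_n -> 'I_B} * 'I_B =>
  `[< out_exps (P ord0) (mnm_of gj.1) gj.2 >]).
have cG : (#|G| <= B ^ c.+1)%N.
  apply: (@leq_trans (B ^ r.+1)); last by rewrite leq_pexp2l.
  pose p (gj : {ffun 'I_n -> 'I_B} * 'I_B) := ([ffun i => gj.1 (f i)], gj.2).
  have pinj : {in G &, injective p}.
    move=> [g j] [g' j']; rewrite !inE /= => /asboolP og /asboolP og' [/ffunP gg jj].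
    rewrite -jj /= in og' *; congr (_, _); apply/ffunP => i; apply: val_inj => /=.
    have mgg : mnm_of g = mnm_of g'.
      apply: (out_inj _ _ j (asboolW og) (asboolW og')) => i'; rewrite !mnmE.
      by have := gg i'; rewrite !ffunE => ->.
    by have := congr1 (fun m : multinom n => m i) mgg; rewrite !mnmE.
  rewrite -(card_in_imset pinj) (leq_trans (max_card _)) //.
  by rewrite card_prod card_ffun !card_ord expnSr.
apply: leq_trans cG; rewrite leqNgt; apply/negP => lt.
(* With more elements z than monomials outside the prime, some nontrivial combination has no such
   monomial and so lies in the prime, against independence. *)
pose M : 'M[k]_(#|X|, #|G|) :=
  \matrix_(x < #|X|, g < #|G|)
    rees_coef (z (enum_val x)) (mnm_of (enum_val (A := mem G) g).1) (enum_val (A := mem G) g).2.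
have /rowV0Pn[v /sub_kermxP vM v0] : kermx M != 0.
  by rewrite kermx_eq0 /row_free; apply/eqP => rM; have := rank_leq_col M; rewrite rM leqNgt lt.
pose co x := v 0 (enum_rank x).
have : P ord0 (\sum_x rees_scalar I (co x) * z x).
  apply: rees_in_ideal; first by case: prP0.
  move=> m j nz; apply: contrapT => Pm; have Am := rees_coefP nz; move/eqP: nz; apply.
  have coefE : rees_coef (\sum_x rees_scalar I (co x) * z x) m j = \sum_x co x * rees_coef (z x)
    m j.
    rewrite /rees_coef rmorph_sum coef_sum raddf_sum; apply: eq_bigr => x _ /=.
    transitivity (mcoeff m ((mpolyC n (co x))%:P * val (z x))`_j); first by [].
    by rewrite coefCM mcoeffCM.
  (* Beyond the box all coefficients vanish by the degree bound on the z x. *)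
  rewrite coefE; have [mj|] := pselect ((forall i, (m i < B)%N) /\ (j < B)%N); last first.
    move=> nmj; apply: big1 => x _; apply/eqP; rewrite mulf_eq0; apply/orP; right.
    apply: contrapT => /negP /bz[hm hj]; apply: nmj; rewrite /B ltnS; split=> // i.
    by rewrite ltnS (leq_trans _ hm) // mdegE (bigD1 i) //= leq_addr.
  have [mB jB] := mj.
  pose g := ([ffun i => Ordinal (mB i)], Ordinal jB).
  have mg : mnm_of g.1 = m by apply/mnmP => i; rewrite mnmE ffunE.
  have gG : g \in G.
    by rewrite inE mg /=; apply/asboolP.
  transitivity ((v *m M) 0 (enum_rank_in gG g)); last by rewrite vM mxE.
  rewrite mxE (reindex_onto (@enum_rank X) (@enum_val X X)) /=; last by move=> i _;
    rewrite enum_valK.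
  apply: eq_big => [x|x _]; first by rewrite enum_rankK eqxx.
  by rewrite [M _ _]mxE enum_rankK enum_rankK_in // mg.
move/iz => co0; move/eqP: v0; apply; apply/rowP => i; rewrite mxE.
by have := co0 (enum_val i); rewrite /co enum_valK.
Qed.

End SymbolicFiber.

(** * Lattice points in the cone over a face *)

Section InteriorExponents.
Variables (R : realType) (n : nat) (b : {set 'I_n} -> nat).
Implicit Types (m : multinom n) (F : {set 'I_n}).
Local Notation P := (polyh (R := R) b).

(** The tight set of a convex combination depends only on the vertices used with positive weight.
    Equal weights therefore give the same face as q, and c clears the denominators of the
    vertices. *)
Lemma interior_exps c q : (0 < c)%N ->
  (forall v, P v -> corank R (tight b v) = 0%N ->
     exists z : 'I_n -> int, forall i, c%:R * v 0 i = (z i)%:~R) ->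
  P q -> covers (tight b q) ->
  exists m j, [/\ (0 < j)%N, symb_exps b j m & tset b m j = tight b q].
Proof.
move=> c0 cv Pq cq; have [s [_ sP s1 sq]] := caratheodory Pq cq.
have sP' a : a \in s -> 0 < a.1 /\ P a.2 by move=> /sP[].
have cR : c%:R != 0 :> R by rewrite pnatr_eq0 -lt0n.
have s0 : (0 < size s)%N.
  by case: (s) s1 => // /eqP; rewrite big_nil eq_sym oner_eq0.
have sR : (size s)%:R != 0 :> R by rewrite pnatr_eq0 -lt0n.
pose m := \big[@mnm_add n/mnm0]_(p <- s) floor_mnm (c%:R *: p.2).
pose j := (size s * c)%N; have j0 : (0 < j)%N by rewrite muln_gt0 s0.
pose t : seq (R * 'rV[R]_n) := [seq ((size s)%:R^-1, p.2) | p <- s].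
have tP a : a \in t -> 0 < a.1 /\ P a.2.
  by move=> /mapP[p /sP[_ Pp _ _] ->]; rewrite invr_gt0 ltr0n.
have t1 : \sum_(a <- t) a.1 = 1.
  by rewrite big_map big_const_seq count_predT iter_addr_0 -[(_^-1) *+ _]mulr_natr mulVf.
have tE : \sum_(a <- t) a.1 *: a.2 = j%:R^-1 *: mnm_row R m.
  have -> : mnm_row R m = \sum_(p <- s) c%:R *: p.2.
    have : forall p, p \in s -> mnm_row R (floor_mnm (c%:R *: p.2)) = c%:R *: p.2.
      by move=> p /sP[_ Pp cp _]; apply: floor_mnmK => //; exact: cv.
    rewrite /m; elim: (s) => [|p s' IHs] h; first by rewrite !big_nil; apply/rowP => i;
      rewrite !mxE mnm0E.
    rewrite !big_cons -IHs => [|p' ps]; last by apply: h; rewrite in_cons ps orbT.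
    rewrite -[X in _ = X + _](h p (mem_head _ _)); apply/rowP => i;
      by rewrite [LHS]mxE [RHS]mxE !mxE mnmDE natrD.
  rewrite big_map -!scaler_sumr scalerA natrM; congr (_ *: _).
  by field; rewrite cR.
have T F : F \in tight b q <-> F \in tset b m j.
  rewrite (tset_polyh b R) //.
  apply: iff_trans (tight_barycenter sP' s1 sq F) _.
  apply: iff_trans (iff_sym (tight_barycenter tP t1 tE F)).
  split=> h a; first by move=> /mapP[p ps ->]; exact: (h p ps).
  by move=> as_; apply: (h ((size s)%:R^-1, a.2)); apply/mapP; exists a.
exists m, j; split=> //; last by apply/setP => F; apply/idP/idP => [/(T F).2|/(T F).1].
apply/(symb_exps_polyh R) => // F; rewrite -tE subsum_sum.
have -> : (b F)%:R = \sum_(a <- t) a.1 * (b F)%:R by rewrite -mulr_suml t1 mul1r.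
rewrite big_seq [leRHS]big_seq; apply: ler_sum => a /tP[a0 Pa].
by rewrite subsumZ ler_wpM2l // ltW.
Qed.

(** The bounds that are not tight at m have slack at least 1, hence slack at least e at e m. Taking
    for e the sum of the absolute values of the l_i leaves room for the shift by l; the singletons
    keep it nonnegative. *)
Lemma shift_exps m j (l : 'I_n -> int) : symb_exps b j m ->
  {in tset b m j, forall F, \sum_(i in F) l i = 0} ->
  exists e m', [/\ symb_exps b (e * j) m', tset b m j \subset tset b m' (e * j) &
    forall i, (m' i)%:Z = (e * m i)%:Z + l i].
Proof.
move=> hm hl; pose e := (\sum_i `|l i|)%N.
have lF F : `|\sum_(i in F) l i| <= e%:Z.
  apply: le_trans (ler_norm_sum _ _ _) _; rewrite /e.
  rewrite (big_morph _ PoszD (erefl _)) [leLHS]big_mkcond; apply: ler_sum => i _.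
  by case: ifP => // _; rewrite abszE.
have key F : (e * j * b F)%:Z <= (e * degs F m)%:Z + \sum_(i in F) l i.
  case: (boolP (F \in tset b m j)) => Ft.
    by rewrite hl // addr0; move: Ft; rewrite inE => /eqP ->; rewrite mulnA.
  have gap : (j * b F < degs F m)%N by move: Ft (hm F); rewrite inE ltn_neqAle eq_sym => -> ->.
  have := lF F; rewrite ler_norml => /andP[h _].
  have : (e * (j * b F).+1 <= e * degs F m)%N by rewrite leq_mul2l gap orbT.
  rewrite mulnS -mulnA; move: (e * (j * b F))%N (e * degs F m)%N (\sum_(i in F) l i) h => A D L;
    lia.
pose m' := Multinom [tuple absz ((e * m i)%:Z + l i)%R | i < n].
have m'E i : (m' i)%:Z = (e * m i)%:Z + l i.
  rewrite mnmE gez0_abs //; have := key (finset.set1 i); rewrite /degs !big_set1.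
  by apply: le_trans.
have dE F : (degs F m')%:Z = (e * degs F m)%:Z + \sum_(i in F) l i.
  rewrite /degs (big_morph _ PoszD (erefl _)) big_distrr /= (big_morph _ PoszD (erefl _))
    -big_split.
  by apply: eq_bigr => i _; exact: m'E.
exists e, m'; split=> // [F|]; first by rewrite -lez_nat dE key.
apply/fintype.subsetP => F Ft; rewrite inE -eqz_nat dE hl // addr0 eqz_nat.
by move: Ft; rewrite inE => /eqP ->; rewrite mulnA.
Qed.

End InteriorExponents.

(** * A chain of primes of maximal length from a compact face *)

Section FaceMorphism.
Variables (k : fieldType) (n : nat) (b : {set 'I_n} -> nat).
Hypothesis hb : antichain_bounds b.
Implicit Types (m : multinom n) (F C : {set 'I_n}).
Let I : set (mpoly n k) := mono_span (symb_exps b 1).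
Local Notation rees := (symb_rees I).
Local Notation fib := (@fiber_ideal k n I).

(** Lowest coefficients multiply; this makes [face_map] multiplicative, as the weights on I^(j)
    start at j B. *)
Lemma low_coefM (D : idomainType) (p q : {poly D}) a c :
  (forall l, (l < a)%N -> p`_l = 0) -> (forall l, (l < c)%N -> q`_l = 0) ->
  (p * q)`_(a + c) = p`_a * q`_c.
Proof.
move=> p0 q0; rewrite coefM; have ac : (a < (a + c).+1)%N by rewrite ltnS leq_addr.
rewrite (bigD1 (Ordinal ac)) //= addKn big1 ?addr0 // => i ia.
case: (ltngtP i a) => [/p0 ->|ai|e]; first by rewrite mul0r.
  by rewrite q0 ?mulr0 //; have := ltn_ord i; lia.
by case/eqP: ia; exact: val_inj.
Qed.

Definition forget_vars C : mpoly n k -> mpoly n k :=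
  locked (mmap (@mpolyC n k) (fun i => if i \in C then mpolyX k (mnm1 i) else 1)).

Lemma forget_vars_zmod_morphism C : zmod_morphism (forget_vars C).
Proof. by rewrite /forget_vars -lock; exact: raddfB. Qed.

Lemma forget_vars_monoid_morphism C : monoid_morphism (forget_vars C).
Proof. by rewrite /forget_vars -lock; split; [exact: rmorph1|exact: rmorphM]. Qed.

HB.instance Definition _ C :=
  GRing.isZmodMorphism.Build _ _ (forget_vars C) (forget_vars_zmod_morphism C).
HB.instance Definition _ C :=
  GRing.isMonoidMorphism.Build _ _ (forget_vars C) (forget_vars_monoid_morphism C).

Definition mnm_restr C m : multinom n := Multinom [tuple (if i \in C then m i else 0)%N | i < n].

Lemma forget_varsX C m : forget_vars C (mpolyX k m) = mpolyX k (mnm_restr C m).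
Proof.
rewrite /forget_vars -lock mmapX /mmap1 [RHS]mpolyXE_id; apply: eq_bigr => i _.
by rewrite mnmE; case: ifP; rewrite ?expr1n ?expr0.
Qed.

Lemma forget_varsZ C a p : forget_vars C (a *: p) = a *: forget_vars C p.
Proof. by rewrite /forget_vars -lock mmapZ mul_mpolyC. Qed.

Lemma forget_vars_comp C C' p : C' \subset C ->
  forget_vars C' (forget_vars C p) = forget_vars C' p.
Proof.
move=> /fintype.subsetP CC'.
have restrK m : mnm_restr C' (mnm_restr C m) = mnm_restr C' m.
  by apply/mnmP => i; rewrite !mnmE; case: ifP => // /CC' ->.
elim/mpolyind: p => [|a m p _ _ IHp]; first by rewrite !raddf0.
by rewrite !raddfD /= !forget_varsZ !forget_varsX restrK IHp.
Qed.

Variable T : {set {set 'I_n}}.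
Hypothesis cT : covers T.
(** With these weights x^m has weight the sum of its F-degrees over T. On I^(j) this is at least j
    B, with equality exactly for the monomials tight on T. *)
Let d (i : 'I_n) := (\sum_(F in T) (i \in F))%N.
Let B := (\sum_(F in T) b F)%N.

Let wdeg_d m : wdeg d m = (\sum_(F in T) degs F m)%N.
Proof.
rewrite /wdeg /d; under eq_bigr do rewrite big_distrl.
rewrite exchange_big; apply: eq_bigr => F _; rewrite /degs [RHS]big_mkcond.
by apply: eq_bigr => i _ /=; case: (i \in F); rewrite ?mul1n ?mul0n.
Qed.

Local Notation w := (@weight_map k n d).
Let w0 : w 0 = 0. Proof. exact: raddf0. Qed.
Let w1 : w 1 = 1. Proof. exact: rmorph1. Qed.
Let wB f g : w (f - g) = w f - w g. Proof. exact: raddfB. Qed.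
Let wM f g : w (f * g) = w f * w g. Proof. exact: rmorphM. Qed.
Let w_sum N (f : 'I_N -> mpoly n k) : w (\sum_i f i) = \sum_i w (f i).
Proof. exact: raddf_sum. Qed.

Let w_low j (f : mpoly n k) l : (l < j * B)%N -> mono_span (symb_exps b j) f -> (w f)`_l = 0.
Proof.
move=> lj fj; apply/mpolyP => m; rewrite mcoeff0 coef_weight_map; case: eqP => // ml.
apply: memN_msupp_eq0; apply/negP => /fj mj; move: lj; rewrite -ml wdeg_d ltnNge big_distrr.
by rewrite leq_sum.
Qed.

Fact face_map_subproof (r : rees) :
  {p : {poly mpoly n k} | forall j, p`_j = (w (val r)`_j)`_(j * B)}.
Proof.
exists (\poly_(j < size (val r)) (w (val r)`_j)`_(j * B)) => j.
by rewrite coef_poly; case: ltnP => // h; rewrite [(val r)`_j]nth_default // w0 coef0.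
Qed.

(* The coefficients of least possible weight: the monomials outside the face die. *)
Definition face_map (r : rees) : {poly mpoly n k} := sval (face_map_subproof r).

Lemma coef_face_map r j : (face_map r)`_j = (w (val r)`_j)`_(j * B).
Proof. exact: svalP (face_map_subproof r) j. Qed.

Lemma face_map_zmod_morphism : zmod_morphism face_map.
Proof.
move=> r s; apply/polyP => j; rewrite coefB !coef_face_map.
have -> : (val (r - s))`_j = (val r)`_j - (val s)`_j by exact: coefB.
by rewrite wB coefB.
Qed.

Let rees_low (r : rees) j : mono_span (symb_exps b j) (val r)`_j.
Proof. by move=> m mr; apply: (rees_coefP hb (r := r)); rewrite /rees_coef -mcoeff_msupp. Qed.

Lemma face_map_monoid_morphism : monoid_morphism face_map.
Proof.
split=> [|r s]; apply/polyP => j; rewrite coef_face_map.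
  have -> : (val (1 : rees))`_j = (j == 0%N)%:R by exact: coef1.
  case: (j =P 0%N) => [->|_]; last by rewrite w0 coef0.
  by rewrite w1 coef1.
have -> : (val (r * s))`_j = \sum_(i < j.+1) (val r)`_i * (val s)`_(j - i) by exact: coefM.
rewrite coefM w_sum coef_sum; apply: eq_bigr => i _.
have ij : (i <= j)%N by rewrite -ltnS.
have jB : (j * B = i * B + (j - i) * B)%N by rewrite -mulnDl subnKC.
rewrite wM !coef_face_map [(j * B)%N]jB.
rewrite low_coefM // => l lj; first exact: (w_low lj (@rees_low r i)).
exact: (w_low lj (@rees_low s (j - i)%N)).
Qed.

HB.instance Definition _ := GRing.isZmodMorphism.Build _ _ face_map face_map_zmod_morphism.
HB.instance Definition _ := GRing.isMonoidMorphism.Build _ _ face_map face_map_monoid_morphism.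

Lemma face_map_mon m j : symb_exps b j m -> T \subset tset b m j ->
  face_map (rees_mon k b m j) = (mpolyX k m)%:P * 'X^j.
Proof.
move=> hm /fintype.subsetP Tm; apply/polyP => i; rewrite coef_face_map rees_monE // !coefCM !coefXn.
case: eqP => [->|_]; last by rewrite !mulr0 w0 coef0.
rewrite !mulr1 weight_mapX coefCM coefXn.
have -> : wdeg d m = (j * B)%N.
  by rewrite wdeg_d big_distrr; apply: eq_bigr => F /Tm; rewrite inE => /eqP.
by rewrite eqxx mulr1.
Qed.

(** Since T covers, every variable has positive weight, so constants from the irrelevant ideal have
    no part of weight 0. *)
Lemma face_map_fiber r : fib r -> face_map r = 0.
Proof.
apply: (ideal_gen_min (J := [set r | face_map r = 0])).
  split=> [|x y /= x0 y0|a x /= x0] /=; first by rewrite raddf0.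
    by rewrite raddfD /= x0 y0 addr0.
  by rewrite rmorphM /= x0 mulr0.
move=> {}r [f If rE]; apply/polyP => j; rewrite coef_face_map.
have -> : (val r)`_j = if j == 0%N then f else 0 by rewrite rE coefC.
rewrite [RHS]coef0; case: eqP => [->|_]; last by rewrite w0 coef0.
rewrite mul0n; apply/mpolyP => m; rewrite coef_weight_map mcoeff0; case: eqP => // m0.
have : mono_span [set m | (0 < degs finset.setT m)%N] f.
  apply: (ideal_gen_min _ _ If) => [|_ [i _ <-]]; first exact/mono_span_ideal/degs_ge_up.
  by apply/mono_spanX; rewrite /= degs1 inE.
move=> h; apply: memN_msupp_eq0; apply/negP => /h /= /degs_gt0P[i _ mi].
have [F FT iF] := cT i; move: m0; rewrite wdeg_d (bigD1 F) //= => /eqP.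
rewrite addn_eq0 degs_eq0 => /andP[/forall_inP/(_ i iF)].
by rewrite -leqn0 leqNgt mi.
Qed.

Lemma kernel_prime (A : comNzRingType) (D : idomainType) (g : {rmorphism A -> D}) :
  prime_ideal [set x | g x = 0].
Proof.
split=> [|/=|x y /=].
- split=> [|x y /= x0 y0|a x /= x0]; first by rewrite /= rmorph0.
    by rewrite rmorphD x0 y0 addr0.
  by rewrite rmorphM x0 mulr0.
- by rewrite rmorph1 => /eqP; rewrite oner_eq0.
by rewrite rmorphM => /eqP; rewrite mulf_eq0 => /orP[/eqP|/eqP]; [left|right].
Qed.

Definition face_proj C (x : rees) : {poly mpoly n k} := map_poly (forget_vars C) (face_map x).

Lemma face_proj_prime C : prime_ideal [set x | face_proj C x = 0].
Proof.
exact: (kernel_prime (map_poly (forget_vars C) \o face_map : {rmorphism rees -> {poly mpoly n k}})).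
Qed.

Lemma face_proj_eval_prime C : prime_ideal [set x | (face_proj C x).[1] = 0].
Proof.
exact: (kernel_prime (horner_eval 1 \o (map_poly (forget_vars C) \o face_map)
  : {rmorphism rees -> mpoly n k})).
Qed.

Lemma face_proj_sub C C' x : C' \subset C -> face_proj C x = 0 -> face_proj C' x = 0.
Proof.
move=> CC' x0; apply/polyP => j; have /polyP/(_ j) := x0; rewrite !coef_map !coef0 /= => h.
by rewrite -(forget_vars_comp _ CC') h raddf0.
Qed.

Lemma face_proj_mon C m j : symb_exps b j m -> T \subset tset b m j ->
  face_proj C (rees_mon k b m j) = (mpolyX k (mnm_restr C m))%:P * 'X^j.
Proof.
move=> hm Tm; rewrite /face_proj face_map_mon // rmorphM /= map_polyXn map_polyC /=.
by rewrite forget_varsX.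
Qed.

Lemma face_projB C x y : face_proj C (x - y) = face_proj C x - face_proj C y.
Proof. by rewrite /face_proj !raddfB. Qed.

Lemma mpolyX_inj : injective (@mpolyX n k).
Proof.
move=> m m' e; have : m \in msupp (mpolyX k m') by rewrite -e msuppX mem_head.
by rewrite msuppX mem_seq1 => /eqP.
Qed.

Lemma polyCXn_inj (A : nzRingType) j : injective (fun a : A => a%:P * 'X^j).
Proof. by move=> x y /polyP/(_ j); rewrite !coefCM !coefXn eqxx !mulr1. Qed.

Lemma face_proj_binomial C m m' j : symb_exps b j m -> T \subset tset b m j ->
  symb_exps b j m' -> T \subset tset b m' j ->
  face_proj C (rees_mon k b m j - rees_mon k b m' j) = 0 <->
  mnm_restr C m = mnm_restr C m'.
Proof.
move=> hm Tm hm' Tm'.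
rewrite face_projB (face_proj_mon C hm Tm) (face_proj_mon C hm' Tm').
split=> [/eqP|->]; last by rewrite subrr.
by rewrite subr_eq0 => /eqP/polyCXn_inj/mpolyX_inj.
Qed.

Lemma face_proj_fiber C x : fib x -> face_proj C x = 0.
Proof. by move=> /face_map_fiber x0; rewrite /face_proj x0 raddf0. Qed.

(* Set more and more of the variables outside independent coordinates of the face to 1;
   the integral dual vectors show that this enlarges the kernel. *)
Lemma face_chain r (f : 'I_r -> 'I_n) (N : nat) (l : 'I_r -> 'I_n -> int) m0 j0 :
  (0 < N)%N -> (forall j, {in T, forall F, \sum_(i in F) l j i = 0}) ->
  (forall j j', l j (f j') = if j == j' then N%:Z else 0) ->
  (0 < j0)%N -> symb_exps b j0 m0 -> tset b m0 j0 = T ->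
  exists2 P : 'I_r.+2 -> set rees, prime_chain P & forall i, fib `<=` P i.
Proof.
move=> N0 lT lf j00 hm0 Tm0.
pose C u := finset (fun i : 'I_n => [exists j : 'I_r, (j < u)%N && (f j == i)]).
have CS u u' : (u <= u')%N -> C u \subset C u'.
  move=> uu; apply/fintype.subsetP => i; rewrite !inE => /existsP[j /andP[ju fj]].
  by apply/existsP; exists j; rewrite (leq_trans ju).
(* The first r + 1 kernels retain r, r - 1, ..., 0 of the chosen coordinates, and the last one also
   sets t to 1. *)
pose P (i : 'I_r.+2) := if (i <= r)%N then [set x | face_proj (C (r - i)%N) x = 0]
  else [set x | (face_proj finset.set0 x).[1] = 0].
exists P; last first.
  by move=> i x fx; rewrite /P; case: ifP => _ /=; rewrite face_proj_fiber // horner0.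
split=> [i|i j ij].
  by rewrite /P; case: ifP => _; [exact: face_proj_prime|exact: face_proj_eval_prime].
have ir : (i <= r)%N by have := ltn_ord j; lia.
rewrite /P ir; case: (leqP j r) => jr.
  split=> [x /=|]; first by apply/face_proj_sub/CS; lia.
  (* The coordinate with index r - j is retained at step i and lost at step j. Shifting a multiple
     of m0 by its dual vector changes no other chosen coordinate, so the resulting binomial is in
     the larger kernel only. *)
  have ur : (r - j < r)%N by lia.
  pose u := Ordinal ur.
  have lu : {in tset b m0 j0, forall F, \sum_(i in F) l u i = 0} by rewrite Tm0; exact: lT.
  have [e [m' [hm' Tm' m'E]]] := shift_exps hm0 lu; rewrite Tm0 in Tm'.
  have hem : symb_exps b (e * j0) (mnm_muln m0 e).
    by move=> F; rewrite degs_muln -mulnA mulnC leq_mul2r hm0 orbT.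
  have Tem : T \subset tset b (mnm_muln m0 e) (e * j0).
    rewrite -Tm0; apply/fintype.subsetP => F; rewrite !inE degs_muln => /eqP ->.
    by rewrite mulnC mulnA.
  pose x := rees_mon k b m' (e * j0) - rees_mon k b (mnm_muln m0 e) (e * j0).
  have eqC C' : face_proj C' x = 0 <-> mnm_restr C' m' = mnm_restr C' (mnm_muln m0 e).
    exact: face_proj_binomial.
  move=> /(_ x) /= h; have /mnmP/(_ (f u)) :
    mnm_restr (C (r - i)%N) m' = mnm_restr (C (r - i)%N) (mnm_muln m0 e).
    apply/eqC/h/eqC/mnmP => i'; rewrite !mnmE; case: ifP => //; rewrite inE =>
      /existsP[j' /andP[j'u /eqP <-]].
    apply/eqP; rewrite -eqz_nat m'E mulmnE mulnC lf; case: (u =P j') => [uj|_];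
      last by rewrite addr0.
    by move: j'u; rewrite -uj /= ltnn.
  have fu : f u \in C (r - i)%N by rewrite inE; apply/existsP; exists u; rewrite eqxx andbT /=; lia.
  rewrite !mnmE fu => /eqP; rewrite -eqz_nat m'E lf eqxx mulmnE mulnC.
  by rewrite -[X in _ == X]addr0 (inj_eq (addrI _)); case: (N) N0.
split=> [x /=|]; first by move=> /(face_proj_sub (finset.sub0set _)) ->; rewrite horner0.
have Tm : T \subset tset b m0 j0 by rewrite Tm0.
have one C' : face_proj C' 1 = 1 by rewrite /face_proj !rmorph1.
have xE C' : face_proj C' (rees_mon k b m0 j0 - 1) = (mpolyX k (mnm_restr C' m0))%:P * 'X^j0 - 1.
  by rewrite face_projB one face_proj_mon.
(* This element becomes t^j0 - 1 once all variables are 1; it vanishes at t = 1 but not before,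
   since j0 > 0. *)
move=> /(_ (rees_mon k b m0 j0 - 1)) /= h.
have : face_proj (C (r - i)%N) (rees_mon k b m0 j0 - 1) = 0.
  apply: h; rewrite xE.
  have -> : mnm_restr finset.set0 m0 = mnm0 by apply/mnmP => i'; rewrite mnmE inE mnm0E.
  by rewrite mpolyX0 mul1r !hornerE expr1n subrr.
rewrite xE => /eqP; rewrite subr_eq0 => /eqP/polyP/(_ j0).
rewrite coefCM coefXn eqxx mulr1 coef1.
case: (j0) j00 => // j1 _ /= /(congr1 (mcoeff (mnm_restr (C (r - i)%N) m0))).
by rewrite mcoeffX eqxx mcoeff0 => /eqP; rewrite oner_eq0.
Qed.

End FaceMorphism.

(** * The symbolic analytic spread *)

Section FiberDimension.
Variables (R : realType) (k : fieldType) (n : nat) (b : {set 'I_n} -> nat).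
Hypothesis hb : antichain_bounds b.
Let I : set (mpoly n k) := mono_span (symb_exps b 1).

Lemma symb_fiber_dim c q0 : (0 < c)%N ->
  (forall v, polyh (R := R) b v -> corank R (tight b v) = 0%N ->
     exists z : 'I_n -> int, forall i, c%:R * v 0 i = (z i)%:~R) ->
  polyh b q0 -> covers (tight (R := R) b q0) ->
  (forall q, polyh (R := R) b q -> covers (tight b q) ->
     (corank R (tight b q) <= corank R (tight b q0))%N) ->
  is_symb_spread I (corank R (tight b q0)).+1.
Proof.
move=> c0 cv Pq0 cq0 qmax.
pose p : {rmorphism symb_rees I -> symb_fiber I} := \pi_(symb_fiber I)%qT.
have ker x : p x = 0 <-> fiber_ideal x.
  apply: (@iff_trans _ (x \in @fiber_pred k n I)); last by split=> [/asboolP|h] //; exact/asboolP.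
  have := Quotient.idealrBE (@fiber_pred k n I) x 0; rewrite subr0 => ->.
  rewrite -(rmorph0 p).
  by split=> [h|/eqP//]; exact/eqP.
apply: (krull_dim_surj (p := p)).
- by move=> y; exists (repr y); rewrite /p /= reprK.
- have [m0 [j0 [j00 hm0 Tm0]]] := interior_exps c0 cv Pq0 cq0.
  have [r [f [<- _ [N N0 [l [lT lf]]]]]] := kernel_coords R (tight b q0).
  have [P chP fP] := face_chain k hb cq0 N0 lT lf j00 hm0 Tm0.
  by exists P => // i x /ker; exact: fP.
- move=> e P chP kerP; apply: (fiber_chain_le hb Pq0 cq0 qmax chP) => i x /ker.
  exact: kerP.
Qed.

End FiberDimension.

(** * Denominators, trivial ideals and the final bounds *)

Section Assembly.
Variables (R : realType) (k : fieldType) (n : nat) (b : {set 'I_n} -> nat).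
Hypothesis hb : antichain_bounds b.
Implicit Types (v q : 'rV[R]_n) (vs : seq 'rV[R]_n) (F : {set 'I_n}).
Let I : set (mpoly n k) := mono_span (symb_exps b 1).
Local Notation SP := (symbolic_polyhedron R I).

Lemma lcm_denominators_gt0 vs : (forall v, v \in vs -> exists w : 'rV[rat]_n, v = map_mx ratr w) ->
  (0 < lcm_denominators vs)%N.
Proof.
move=> h; rewrite /lcm_denominators big_seq; apply: (big_ind (fun x => (0 < x)%N)) =>
  // [x y|v vvs].
  by rewrite lcmn_gt0 => -> ->.
apply: (big_ind (fun x => (0 < x)%N)) => // [x y|i _]; first by rewrite lcmn_gt0 => -> ->.
have [w ->] := h v vvs; rewrite mxE denominator_ratr absz_gt0; exact: denq_neq0.
Qed.

(** The two cases are the unit ideal and the zero ideal. *)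
Lemma exps_veronese1 : (forall F, b F = 0%N) \/ (0 < b finset.set0)%N -> exps_veronese b 1.
Proof.
move=> h e e0; rewrite mul1n; apply/seteqP; split=> m; last first.
  by move/sumset_pow_sub; rewrite mul1n.
case: h => [b0 _|b0 /(_ finset.set0)]; last first.
  by rewrite /degs big_set0 leqn0 muln_eq0 !eqn0Ngt e0 b0.
elim: e m {e0} => [//|e IHe] m; rewrite /sumset_pow iterS.
exists m, mnm0; split.
- by move=> F; rewrite b0 muln0.
- exact: IHe.
- by rewrite addm0.
Qed.

(** Needed for the unit ideal, whose symbolic polyhedron is the whole space: a vertex, possible only
    for n = 0, contributes the denominator 1. *)
Lemma setT_vertex v : is_vertex setT v -> v = 0.
Proof.
move=> [_ [a [c [ac e]]]]; have va : dot a v = c.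
  have : [set v] v by [].
  by rewrite e => -[].
have d0 : dot a 0 = 0 :> R by rewrite -(scale0r 0) dotZ mul0r.
have c0 : c = 0.
  apply/eqP; rewrite eq_le -{1}d0 ac //=.
  by have := ac (2 *: v) Logic.I; rewrite dotZ va; lra.
have : [set v] 0 by rewrite e; split=> //=; rewrite d0 c0.
by move=> ->.
Qed.

Lemma lcm_denominators_veronese vs d : (forall v, v \in vs -> is_vertex SP v) ->
  (0 < d)%N -> symb_veronese I d -> (lcm_denominators vs %| d)%N.
Proof.
move=> vsP d0 dV; apply/lcm_denominators_dvd => v i /vsP vv.
have [[F bF]|nF] := pselect (exists F, (0 < b F)%N).
  rewrite (symbolic_polyhedronE R k hb bF) in vv.
  by apply: (vertex_denominator_dvd i d0 _ vv); exact: (symb_veronese_exps k hb d).1 dV.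
have b0 F : b F = 0%N by apply/eqP; rewrite eqn0Ngt; apply/negP => bF; apply: nF; exists F.
rewrite symbolic_polyhedron_setT // in vv; rewrite (setT_vertex vv) mxE.
by apply: (@denominator_dvd R d _ 0) => //; rewrite mulr0.
Qed.

Lemma polyh_nonempty : b finset.set0 = 0%N -> exists x, polyh (R := R) b x.
Proof.
move=> b0; exists (const_mx (\sum_F b F)%:R) => F.
have [->|[i iF]] := set_0Vmem F; first by rewrite b0 subsum_nneg // => i; rewrite mxE.
rewrite /subsum (bigD1 i) //= mxE -[leLHS]addr0; apply: lerD.
  by rewrite ler_nat (bigD1 F) //= leq_addr.
by apply: sumr_ge0 => j _; rewrite mxE.
Qed.

Section Proper.
Variables (vs : seq 'rV[R]_n) (F0 : {set 'I_n}).
Hypotheses (b0 : b finset.set0 = 0%N) (bF0 : (0 < b F0)%N).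
Hypothesis vsP : forall v, v \in vs <-> is_vertex SP v.
Local Notation c := (lcm_denominators vs).

Let vs_polyh v : v \in vs <-> polyh b v /\ corank R (tight b v) = 0%N.
Proof.
apply: iff_trans (vsP v) _; rewrite (symbolic_polyhedronE R k hb bF0).
exact: vertex_corank.
Qed.

Let c_gt0 : (0 < c)%N.
Proof. by apply: lcm_denominators_gt0 => v /vs_polyh[]; exact: vertex_rational. Qed.

Let c_integral v : polyh b v -> corank R (tight b v) = 0%N ->
  exists z : 'I_n -> int, forall i, c%:R * v 0 i = (z i)%:~R.
Proof.
move=> Pv cv; have vvs : v \in vs by apply/vs_polyh.
have [w vE] := vertex_rational Pv cv.
have /boolp.choice[z zE] : forall i, exists z : int, c%:R * v 0 i = z%:~R.
  move=> i; rewrite vE mxE; apply: denominator_mul; move/lcm_denominators_dvd: (dvdnn c).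
  by move=> /(_ _ i vvs); rewrite vE mxE.
by exists z.
Qed.

(** The maximum with 1 keeps the Veronese degree positive when all compact faces are vertices, that
    is, for m = 0. *)
Lemma symbolic_spread_mdc : exists m,
  [/\ is_mdc SP m, is_symb_spread I m.+1, (0 < maxn 1 m * c)%N & symb_veronese I (maxn 1 m * c)].
Proof.
have [x Px] := polyh_nonempty b0; have [q [Pq cq mdcq qmax]] := mdc_polyh Px.
exists (corank R (tight b q)); split.
- by rewrite (symbolic_polyhedronE R k hb bF0).
- exact: (symb_fiber_dim k hb c_gt0 c_integral).
- by rewrite muln_gt0 c_gt0 leq_max.
- apply/(symb_veronese_exps k hb)/(@exps_veronese_mul R) => //.
    by rewrite leq_max.
  by move=> q' Pq' cq'; rewrite leq_max qmax ?orbT.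
Qed.

End Proper.

End Assembly.

Theorem theorem6p1 (R : realType) (k : fieldType) (n : nat)
    (I : set (mpoly n k)) (vs : seq 'rV[R]_n) :
  linear_power_type I ->
  (forall v, v \in vs <-> is_vertex (symbolic_polyhedron R I) v) ->
  let c := lcm_denominators vs in
  [/\ (* (1) *)
      forall d, (0 < d)%N -> symb_veronese I d -> (c %| d)%N,
      (* (1), in particular *)
      exists s, [/\ is_svd I s, (c %| s)%N & (c <= s)%N] &
      (* (2) *)
      I <> [set 0] -> I <> setT ->
      exists s l m,
        [/\ is_svd I s, is_symb_spread I l,
            is_mdc (symbolic_polyhedron R I) m,
            l = m.+1 &
            (* for l = 1, i.e. I principal, the right-hand side is 0 < s *)
            (1 < l)%N -> (s <= (l - 1) * c)%N]].
Proof.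
move=> /linear_power_typeP[b hb ->] vsP c.
set I' := mono_span _.
have c_dvd d : (0 < d)%N -> symb_veronese I' d -> (c %| d)%N.
  by apply: (lcm_denominators_veronese hb) => v /vsP.
have svdP d : (0 < d)%N -> symb_veronese I' d -> exists2 s, is_svd I' s & (s <= d)%N.
  move=> d0 dV.
  have exV : exists d, `[< (0 < d)%N /\ symb_veronese I' d >] by exists d; apply/asboolP.
  case: (ex_minnP exV) => s /asboolP[s0 sV] smin; exists s; last by apply: smin; apply/asboolP.
  by split=> // e e0 eV; apply: smin; apply/asboolP.
(* Either I is the unit ideal or the zero ideal, with Veronese degree 1, or it is proper and
   nonzero. *)
have [triv|[F0 b0 bF0]] : ((forall F, b F = 0%N) \/ (0 < b finset.set0)%N) \/
    exists2 F0, b finset.set0 = 0%N & (0 < b F0)%N.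
  case: (posnP (b finset.set0)) => [b0|]; last by left; right.
  have [[F bF]|nF] := pselect (exists F, (0 < b F)%N); first by right; exists F.
  left; left=> F; apply/eqP; rewrite eqn0Ngt; apply/negP => bF; apply: nF; exists F.
  exact: bF.
- split=> //.
    have [|//|s sP _] := svdP 1%N; first by [].
      exact/(symb_veronese_exps k hb)/exps_veronese1.
    have [s0 sV _] := sP; exists s; have cs := c_dvd s s0 sV.
    by split=> //; exact: dvdn_leq.
  move=> I0 IT; case: triv => [b0|b0].
    by case: IT; apply/seteqP; split=> // p _ m _ F; rewrite b0.
  case: I0; apply/seteqP; split=> p /=; last by move=> -> m; rewrite msupp0.
  move=> Ip; apply/eqP; rewrite -msupp_eq0; case E: (msupp p) => [//|m s].
  have /(_ finset.set0) : symb_exps b 1 m by apply: Ip; rewrite E mem_head.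
  by rewrite mul1n /degs big_set0 leqn0 eqn0Ngt b0.
have [m [mdcm spread mc0 mV]] := symbolic_spread_mdc hb b0 bF0 vsP.
have [s sP sle] := svdP _ mc0 mV; have [s0 sV _] := sP.
have cs := c_dvd s s0 sV.
split=> //; first by exists s; split=> //; exact: dvdn_leq.
move=> _ _; exists s, m.+1, m; split=> //.
by rewrite ltnS subn1 /= => m0; move: sle; rewrite (maxn_idPr m0).
Qed.
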